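(* Let $n\ge 2$ be an integer. A mapping $G: (SL\mathcal{P}_n, g) \to (SL\mathcal{P}_n, g)$ is an isometry if and only if there exists a matrix $X \in GL_n$ with $\det(X) = \pm 1$ such that $$G = \Gamma_X \quad\text{or}\quad G = \Gamma_X \circ \varphi .$$ Moreover $G$ fixes $I_n$ if and only if the matrix $X$ belongs to $O_n$.
   Context: $GL_n$ is the group of non-singular real $n\times n$ matrices, $O_n$ the group of real orthogonal $n\times n$ matrices, $I_n$ the identity matrix. $SL\mathcal{P}_n$ is the manifold of positive definite real symmetric $n\times n$ matrices with determinant $1$, endowed with the trace metric $g_A(V,W)=\mathrm{tr}(A^{-1}VA^{-1}W)$ for tangent vectors $V,W$ at $A$ (a Riemannian metric on $SL\mathcal{P}_n$). $\Gamma_X(A)=XAX^T$ (congruence by $X$) and $\varphi(A)=A^{-1}$ (inversion), here restricted to $SL\mathcal{P}_n$. An isometry is a diffeomorphism preserving the metric tensor. *)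

(* Defs.v *)
From HB Require Import structures.
From mathcomp Require Import all_boot all_order all_algebra.
From mathcomp Require Import all_classical all_reals all_analysis.

Set Implicit Arguments.
Unset Strict Implicit.
Unset Printing Implicit Defensive.

Import Order.TTheory GRing.Theory Num.Theory.
Import numFieldNormedType.Exports.

Local Open Scope classical_set_scope.
Local Open Scope ring_scope.

(* [U] is meant to be open.  Between finite-dimensional spaces (the only case
   used) this is the usual class C^k: a C^1 map is a differentiable map all of
   whose directional derivatives are continuous. *)
Fixpoint Ck_on (R : realType) (V W : normedModType R) (k : nat) (U : set V)
    (f : V -> W) : Prop :=
  if k is k'.+1 then
    (forall x, U x -> differentiable f x) /\
    (forall v : V, Ck_on k' U ('D_v f))
  else forall x, U x -> {for x, continuous f}.

Definition smooth_on (R : realType) (V W : normedModType R) (U : set V)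
    (f : V -> W) : Prop :=
  forall k, Ck_on k U f.

Definition posdefmx (R : realType) (n : nat) (A : 'M[R]_n) : Prop :=
  A^T = A /\ forall x : 'cV[R]_n, x != 0 -> 0 < (x^T *m A *m x) 0 0.

Definition SLP (R : realType) (n : nat) : set 'M[R]_n :=
  [set A | posdefmx A /\ \det A = 1].
Arguments SLP : clear implicits.

Lemma SLP_1mx (R : realType) (n : nat) : SLP R n 1%:M.
Proof.
split; last exact: det1.
split=> [|x x0]; first exact: trmx1.
rewrite mulmx1 mxE; under eq_bigr do rewrite mxE -expr2.
have [i xi0] : exists i, x i 0 != 0.
  apply: contrapT => x_0; move/eqP: x0; apply; apply/matrixP => i j.
  by rewrite (ord1 j) mxE; apply: contrapT => /eqP xi; apply: x_0; exists i.
rewrite (bigD1 i) //= ltr_wpDr ?sumr_ge0 // => [j _|]; first exact: sqr_ge0.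
by rewrite exprn_even_gt0.
Qed.

Definition SLP1 (R : realType) (n : nat) : SLP R n :=
  exist _ 1%:M (mem_set (SLP_1mx R n)).

(* Velocities at time 0 of smooth curves in SLP_n issued from A. *)
Definition tangent (R : realType) (n : nat) (A : SLP R n) (V : 'M[R]_n) : Prop :=
  exists (c : R -> SLP R n) (U : set R),
    [/\ open U, U 0,
        smooth_on (U : set R^o) (fun t : R^o => val (c t)),
        c 0 = A & derive1 (fun t : R => val (c t)) 0 = V].

Definition trace_metric (R : realType) (n : nat) (A V W : 'M[R]_n) : R :=
  \tr (invmx A *m V *m invmx A *m W).

(* SLP_n is an embedded submanifold of the space of matrices, so a self-map G
   is smooth at A when it extends to a smooth map F on a neighbourhood of A in
   the space of matrices; the tangent map of G at A is then the restriction of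
   'd F A to the tangent space at A, whatever the extension F. *)
Definition smooth_extension (R : realType) (n : nat) (G : SLP R n -> SLP R n)
    (A : SLP R n) (F : 'M[R]_n -> 'M[R]_n) : Prop :=
  exists U : set 'M[R]_n,
    [/\ open U, U (val A), smooth_on U F &
        forall B : SLP R n, U (val B) -> F (val B) = val (G B)].

Definition smooth_map (R : realType) (n : nat) (G : SLP R n -> SLP R n) : Prop :=
  forall A, exists F, smooth_extension G A F.

Definition diffeomorphism (R : realType) (n : nat)
    (G : SLP R n -> SLP R n) : Prop :=
  smooth_map G /\
  exists H : SLP R n -> SLP R n, [/\ cancel G H, cancel H G & smooth_map H].

Definition preserves_metric (R : realType) (n : nat)
    (G : SLP R n -> SLP R n) : Prop :=
  forall (A : SLP R n) (F : 'M[R]_n -> 'M[R]_n), smooth_extension G A F ->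
  forall V W : 'M[R]_n, tangent A V -> tangent A W ->
    trace_metric (val (G A)) ('d F (val A) V) ('d F (val A) W) =
    trace_metric (val A) V W.

Definition is_isometry (R : realType) (n : nat) (G : SLP R n -> SLP R n) : Prop :=
  diffeomorphism G /\ preserves_metric G.

Definition Gamma (R : realType) (n : nat) (X A : 'M[R]_n) : 'M[R]_n :=
  X *m A *m X^T.

Definition inversion (R : realType) (n : nat) (A : 'M[R]_n) : 'M[R]_n :=
  invmx A.

Definition orthogonalmx (R : realType) (n : nat) (X : 'M[R]_n) : Prop :=
  X^T *m X = 1%:M.

Definition det_pm1 (R : realType) (n : nat) (X : 'M[R]_n) : Prop :=
  X \in unitmx /\ (\det X = 1 \/ \det X = -1).

Definition represents (R : realType) (n : nat) (X : 'M[R]_n)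
    (G : SLP R n -> SLP R n) : Prop :=
  (forall A, val (G A) = Gamma X (val A)) \/
  (forall A, val (G A) = (Gamma X \o @inversion R n) (val A)).

(* Main.v *)
Require Import Defs.
From HB Require Import structures.
From mathcomp Require Import all_boot all_order all_algebra perm complex.
From mathcomp Require Import all_classical all_reals all_analysis.
From mathcomp Require Import ring lra.

Set Implicit Arguments.
Unset Strict Implicit.
Unset Printing Implicit Defensive.

Import Order.TTheory GRing.Theory Num.Theory.
Import numFieldNormedType.Exports.

Local Open Scope classical_set_scope.
Local Open Scope ring_scope.

(** The maps [A |-> X A X^T] and [A |-> X A^-1 X^T] are restrictions of
    polynomial maps, since the inverse is the adjugate where the determinant is
    1, and they preserve the trace metric by a computation with traces. The
    substance is the converse.

    Let [G] be an isometry. Its differential intertwines the two Levi-Civita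
    connections; here this is the statement that the image [c] of a geodesic
    [t |-> P e^(tX) P^T] satisfies [c'' = c' c^-1 c'] ([geodesic_acceleration]).
    The argument is Koszul's: along a geodesic in a direction [Y], transport two
    tangent vectors [W] and [Z]; differentiating the identity
    [<dG W, dG Z> = tr(W Z)] shows that the defect [N(Y, W)] of [dG] satisfies
    [<N(Y, W), dG Z> + <N(Y, Z), dG W> = 0], while [N] is symmetric because
    second derivatives commute. A trilinear form symmetric in its first two
    arguments and skew in the last two vanishes. Then [c^-1 c'] is constant and
    [c] is itself a geodesic ([isometry_geodesic]).

    Consequently [G] commutes with the geodesic symmetries [B |-> A B^-1 A].
    After composing with a congruence, [G] fixes the identity, and then
    [G(A B A) = G(A) G(B) G(A)] and [G(e^X) = e^(L X)], where [L] is the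
    differential at the identity, a linear isometry of the traceless symmetric
    matrices for the trace form. If [A] and [C] commute then
    [A C^2 A = C A^2 C], an identity that [G] preserves and that forces
    commutation ([swap_squares_commute]). So [L] and its inverse preserve
    commuting pairs.

    Such an [L] is an orthogonal conjugation up to sign
    ([commutation_isometry]). Write [X_v = v v^T - 1/n] for a unit vector [v].
    The double commutant of [X_v] is a line, hence so is that of [L X_v], which
    therefore has only two eigenvalues. The orthogonal complement of the
    commutant of [X_v] contains no two orthogonal commuting nonzero elements,
    hence the same holds for [L X_v], which makes one of its two spectral
    projections of rank one. Thus [L X_v = +/- X_w]. A common sign can be
    chosen, the standard frame can be brought back to itself by an orthogonal
    conjugation, and what is left is conjugation by a diagonal matrix of
    signs. Since every point of the manifold is some [e^X], [G] is known. *)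

(** * Diagonalization of real symmetric matrices *)

Section RealSymmetric.
Variable R : realType.

Lemma sqnorm_ge0 m n (M : 'M[R]_(m, n)) : 0 <= \tr (M^T *m M).
Proof.
by apply: sumr_ge0 => j _; rewrite mxE sumr_ge0// => i _; rewrite mxE -expr2 sqr_ge0.
Qed.

Lemma sqnorm_eq0 m n (M : 'M[R]_(m, n)) : \tr (M^T *m M) = 0 -> M = 0.
Proof.
have ge0 j : 0 <= (M^T *m M) j j.
  by rewrite mxE sumr_ge0// => i _; rewrite mxE -expr2 sqr_ge0.
move/eqP; rewrite psumr_eq0// => /allP M0; apply/matrixP => i j.
have /M0 := mem_index_enum j; rewrite mxE psumr_eq0; last first.
  by move=> k _; rewrite mxE -expr2 sqr_ge0.
move/allP => /(_ i); rewrite mem_index_enum mxE -expr2 sqrf_eq0 => /(_ isT).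
by move/eqP ->; rewrite mxE.
Qed.

(** Seen over the complex numbers the matrix is Hermitian, so its eigenvalues are
    real, and they are roots of the same characteristic polynomial. *)
Lemma real_symmetric_eigenvalue n (A : 'M[R]_n.+1) : A^T = A ->
  exists a, eigenvalue A a.
Proof.
move=> As; pose AC : 'M[R[i]]_n.+1 := map_mx (real_complex R) A.
have ACh : AC \is hermsymmx.
  apply: realsym_hermsym.
    rewrite qualifE /=; apply/eqP/matrixP => i j; rewrite expr0 scale1r !mxE.
    by rewrite -[in LHS]As mxE.
  by apply/mxOverP => i j; rewrite mxE complex_real.
have /hermitian_normalmx /orthomx_spectralP AE := ACh.
have /mxOverP/(_ 0 0) := hermitian_spectral_diag_real ACh.
set l := spectral_diag AC 0 0 => lr.
exists (complex.Re l).
have lE : l = real_complex R (complex.Re l) by rewrite RRe_real.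
have Punit := spectral_unit AC; set P := spectralmx AC in AE Punit *.
have : eigenvalue AC l.
  apply/eigenvalueP; exists (row 0 P).
    have : P *m AC = diag_mx (spectral_diag AC) *m P.
      by rewrite {1}AE !mulmxA mulmxV// mul1mx.
    move=> /(congr1 (row 0)); rewrite !row_mul => ->.
    by apply/rowP => j; rewrite row_diag_mx -scalemxAl -rowE.
  apply: contraTneq Punit => P0; rewrite -row_free_unit -kermx_eq0.
  apply/negP => /eqP k0; suff /eqP : (delta_mx 0 0 : 'rV[R[i]]_n.+1) = 0.
    by move/eqP/rowP/(_ 0)/eqP; rewrite !mxE !eqxx oner_eq0.
  by apply/eqP; rewrite -submx0 -k0; apply/sub_kermxP; rewrite -rowE.
by rewrite lE !eigenvalue_root_char -map_char_poly fmorph_root.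
Qed.

Lemma reflection_involution n (u : 'rV[R]_n) d : u *m u^T = d%:M -> d != 0 ->
  let Q := 1%:M - (2 / d) *: (u^T *m u) in Q^T = Q /\ Q *m Q = 1%:M.
Proof.
move=> uuE u0 Q; split.
  by rewrite /Q linearB /= linearZ /= trmx_mul trmxK trmx1.
have QuE : (u^T *m u) *m (u^T *m u) = d *: (u^T *m u).
  by rewrite mulmxA -(mulmxA u^T) uuE mul_mx_scalar -scalemxAl.
rewrite /Q mulmxBl mul1mx mulmxBr mulmx1 -scalemxAl -scalemxAr QuE !scalerA.
rewrite -addrA -opprD addrA -scalerDl -scalerBl.
have -> : 2 / d + 2 / d - 2 / d * (2 / d) * d = 0 by field.
by rewrite scale0r subr0.
Qed.

(** The Householder reflection exchanging a unit vector with the first basis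
    vector gives the orthogonal change of basis that splits off an
    eigenvector. *)
Lemma unit_vector_orthogonal_completion n (v : 'rV[R]_n.+1) :
  v *m v^T = 1%:M ->
  exists Q : 'M[R]_n.+1, Q^T = Q /\ Q *m Q = 1%:M /\ row 0 Q = v.
Proof.
move=> v1; pose e : 'rV[R]_n.+1 := delta_mx 0 0.
have ee : e *m e^T = 1%:M.
  by apply/matrixP => i j; rewrite !ord1 trmx_delta mul_delta_mx !mxE !eqxx.
pose u := v - e; pose d := (u *m u^T) 0 0.
have uuE : u *m u^T = d%:M by rewrite -mx11_scalar.
have [u0|u0] := eqVneq d 0.
  have : u^T = 0.
    apply: sqnorm_eq0; rewrite trmxK uuE u0 /mxtrace big1// => i _.
    by rewrite !mxE mul0rn.
  move=> /(congr1 trmx); rewrite trmxK trmx0 => /eqP; rewrite subr_eq0 => /eqP ve.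
  exists 1%:M; split; [exact: trmx1|split; first exact: mulmx1].
  by rewrite ve; apply/rowP => j; rewrite !mxE eq_sym.
exists (1%:M - (2 / d) *: (u^T *m u)); split; [|split].
- exact: (reflection_involution uuE u0).1.
- exact: (reflection_involution uuE u0).2.
- have ev : e *m v^T = (v 0 0)%:M.
    by apply/matrixP => i j; rewrite !ord1 /e -rowE !mxE mulr1n.
  have ve : v *m e^T = (v 0 0)%:M by rewrite -[LHS]trmxK trmx_mul trmxK ev tr_scalar_mx.
  have dE : d = 2 - 2 * v 0 0.
    rewrite /d /u linearB /= mulmxBl !mulmxBr v1 ee ev ve !mxE !eqxx !mulr1n.
    by ring.
  have -> : row 0 (1%:M - (2 / d) *: (u^T *m u)) = e - (2 / d * u 0 0) *: u.
    by apply/rowP => j; rewrite !mxE big_ord1 !mxE eq_sym mulrA !eqxx.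
  have -> : 2 / d * u 0 0 = -1.
    have -> : u 0 0 = - (d / 2) by rewrite dE !mxE !eqxx /=; field.
    by field.
  by rewrite scaleN1r opprK /u addrC subrK.
Qed.

(** Induction on the size: an eigenvector is completed to an orthogonal change
    of basis, in which the symmetric matrix is block diagonal. *)
Theorem real_spectral n (A : 'M[R]_n) : A^T = A ->
  exists (O : 'M[R]_n) (d : 'rV[R]_n),
    O^T *m O = 1%:M /\ A = O^T *m diag_mx d *m O.
Proof.
elim: n A => [|n IH] A As.
  by exists 1%:M, 0; split; apply/matrixP => -[].
have [a /eigenvalueP[w wA w0]] := real_symmetric_eigenvalue As.
pose c := (w *m w^T) 0 0.
have cE : w *m w^T = c%:M by rewrite -mx11_scalar.
have c0 : 0 < c.
  rewrite lt_neqAle; apply/andP; split; last first.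
    by rewrite /c mxE sumr_ge0// => i _; rewrite mxE -expr2 sqr_ge0.
  apply: contra w0 => /eqP c0; rewrite -trmx_eq0; apply/eqP.
  apply: sqnorm_eq0; rewrite trmxK cE -c0 /mxtrace big1// => i _.
  by rewrite !mxE mul0rn.
pose v := (Num.sqrt c)^-1 *: w.
have v1 : v *m v^T = 1%:M.
  rewrite /v linearZ /= -scalemxAl -scalemxAr cE scalerA -invfM -expr2.
  by rewrite sqr_sqrtr ?ltW// scale_scalar_mx mulVf// gt_eqF.
have vA : v *m A = a *: v by rewrite /v -scalemxAl wA !scalerA mulrC.
have [Q [Qs [QQ Qv]]] := unit_vector_orthogonal_completion v1.
have [B BQ] : exists B : 'M[R]_(1 + n), B = Q *m A *m Q by eexists.
have Bs : B^T = B by rewrite BQ !trmx_mul As Qs mulmxA.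
have B0 : row 0 B = a *: delta_mx 0 0.
  rewrite BQ row_mul row_mul Qv vA -scalemxAl -Qv -row_mul QQ.
  by congr (_ *: _); apply/rowP => j; rewrite !mxE eq_sym.
have B00 j : B 0 j = a *+ (j == 0).
  by move/rowP: B0 => /(_ j); rewrite !mxE => ->; rewrite mulr_natr.
have [S [d' [SS AE']]] : exists (O : 'M[R]_n) (d : 'rV[R]_n),
    O^T *m O = 1%:M /\ drsubmx B = O^T *m diag_mx d *m O.
  by apply: IH; rewrite trmx_drsub Bs.
have BE : B = block_mx a%:M 0 0 (drsubmx B).
  rewrite -[LHS]submxK; congr block_mx.
  - apply/matrixP => i j; rewrite !ord1 !mxE.
    have -> : lshift n (0 : 'I_1) = 0 by apply/val_inj.
    by rewrite B00.
  - apply/matrixP => i j; rewrite !mxE.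
    have -> : lshift n i = 0 by apply/val_inj; rewrite /= ord1.
    by rewrite B00.
  - apply/matrixP => i j; rewrite -Bs !mxE.
    have -> : lshift n j = 0 by apply/val_inj; rewrite /= ord1.
    by rewrite B00.
pose P : 'M[R]_(1 + n) := block_mx 1%:M 0 0 S.
have PP : P^T *m P = 1%:M.
  rewrite /P tr_block_mx !trmx0 trmx1 mulmx_block !mulmx0 !mul0mx !addr0 !add0r.
  by rewrite mulmx1 SS -scalar_mx_block.
have BP : B = P^T *m diag_mx (row_mx a%:M d') *m P.
  rewrite diag_mx_row BE AE' /P tr_block_mx !trmx0 trmx1 !mulmx_block.
  rewrite !mulmx0 !mul0mx !addr0 !add0r !mul1mx mulmx1 ?mulmx0 ?mul0mx ?addr0 ?add0r.
  by congr block_mx; apply/matrixP => i j; rewrite !ord1 !mxE.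
exists (P *m Q), (row_mx a%:M d' : 'rV[R]_(1 + n)); split.
  by rewrite trmx_mul Qs mulmxA -(mulmxA Q) PP mulmx1.
have -> : A = Q *m B *m Q.
  by rewrite BQ !mulmxA QQ mul1mx -mulmxA QQ mulmx1.
by rewrite trmx_mul Qs BP !mulmxA.
Qed.

End RealSymmetric.

(** * Functional calculus and the exponential of symmetric matrices *)

Section FunctionalCalculus.
Variables (R : realType) (n : nat).
Implicit Types (f : R -> R) (X Y O P Q M : 'M[R]_n) (d e : 'rV[R]_n).

Lemma orthogonalmx_tr O : orthogonalmx O -> O *m O^T = 1%:M.
Proof. exact: mulmx1C. Qed.

(** An intertwiner of two diagonal matrices vanishes at the entries where the
    eigenvalues differ, hence still intertwines after [f] is applied to the
    eigenvalues. This is why the functional calculus does not depend on the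
    diagonalization and preserves commutation. *)
Lemma diag_intertwine f d e M : diag_mx d *m M = M *m diag_mx e ->
  diag_mx (map_mx f d) *m M = M *m diag_mx (map_mx f e).
Proof.
move=> /matrixP DM; apply/matrixP => i j; have := DM i j.
rewrite !mul_diag_mx !mul_mx_diag !mxE => de.
have [->|M0] := eqVneq (M i j) 0; first by rewrite mulr0 mul0r.
by rewrite [RHS]mulrC; congr (f _ * _); apply: (mulIf M0); rewrite de mulrC.
Qed.

(** Some diagonalization of a symmetric matrix, by [real_spectral]; the default
    value concerns the other matrices only. *)
Definition spectral_pair X : 'M[R]_n * 'rV[R]_n :=
  xget (1%:M, 0) [set p | orthogonalmx p.1 /\ X = p.1^T *m diag_mx p.2 *m p.1].

Definition fcalc f X : 'M[R]_n :=
  let p := spectral_pair X in p.1^T *m diag_mx (map_mx f p.2) *m p.1.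

Lemma fcalcE f O d : orthogonalmx O ->
  fcalc f (O^T *m diag_mx d *m O) = O^T *m diag_mx (map_mx f d) *m O.
Proof.
move=> oO; rewrite /fcalc /spectral_pair; set X := O^T *m _ *m _.
case: xgetP => [[P e] _ /= [oP XE]|/(_ (O, d))[]//].
have PP := orthogonalmx_tr oP; have OO := orthogonalmx_tr oO.
have : diag_mx d *m (O *m P^T) = O *m P^T *m diag_mx e.
  have : O *m X *m P^T = O *m (P^T *m diag_mx e *m P) *m P^T by rewrite XE.
  by rewrite /X !mulmxA OO mul1mx -!mulmxA PP mulmx1 !mulmxA.
move=> /(diag_intertwine f) /(congr1 (fun M => O^T *m M *m P)).
by rewrite !mulmxA oO mul1mx -!mulmxA oP mulmx1 !mulmxA => ->.
Qed.

Lemma fcalc_sym f X : (fcalc f X)^T = fcalc f X.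
Proof. by rewrite /fcalc !trmx_mul trmxK tr_diag_mx mulmxA. Qed.

Lemma fcalc_comm f X Y : X^T = X -> X *m Y = Y *m X ->
  fcalc f X *m Y = Y *m fcalc f X.
Proof.
move=> Xs; have [ O [d [oO ->]]] := real_spectral Xs; rewrite fcalcE// => XY.
have OO := orthogonalmx_tr oO.
have : diag_mx d *m (O *m Y *m O^T) = (O *m Y *m O^T) *m diag_mx d.
  move/(congr1 (fun M => O *m M *m O^T)): XY.
  by rewrite !mulmxA OO mul1mx -!mulmxA OO mulmx1.
move=> /(diag_intertwine f) /(congr1 (fun M => O^T *m M *m O)).
by rewrite !mulmxA oO mul1mx -!mulmxA oO mulmx1.
Qed.

Lemma fcalc_conj f X Q : orthogonalmx Q -> X^T = X ->
  fcalc f (Q *m X *m Q^T) = Q *m fcalc f X *m Q^T.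
Proof.
move=> oQ Xs; have [ O [d [oO ->]]] := real_spectral Xs; rewrite fcalcE//.
have := fcalcE f d (O := O *m Q^T); rewrite trmx_mul trmxK !mulmxA => -> //.
by rewrite /orthogonalmx trmx_mul trmxK -!mulmxA (mulmxA O^T) oO mul1mx
  orthogonalmx_tr.
Qed.

Lemma det_orth_conj O d : orthogonalmx O ->
  \det (O^T *m diag_mx d *m O) = \prod_i d 0 i.
Proof.
move=> oO; rewrite !det_mulmx mulrAC -det_mulmx oO det1 mul1r det_diag.
by apply: eq_bigr.
Qed.

Lemma tr_orth_conj O d : orthogonalmx O ->
  \tr (O^T *m diag_mx d *m O) = \sum_i d 0 i.
Proof.
by move=> oO; rewrite mxtrace_mulC mulmxA orthogonalmx_tr// mul1mx mxtrace_diag.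
Qed.

(** Traceless symmetric matrices: the tangent space of the manifold at the
    identity. *)
Definition symm0 X := X^T = X /\ \tr X = 0.

Fact expmx_key : unit. Proof. exact: tt. Qed.
(** Locked, so that rewriting with associativity does not look inside. *)
Definition expmx := locked_with expmx_key (fcalc (@expR R)).

Lemma expmxE X : expmx X = fcalc (@expR R) X.
Proof. by rewrite /expmx unlock. Qed.

Lemma expmx_sym X : (expmx X)^T = expmx X.
Proof. by rewrite expmxE; exact: fcalc_sym. Qed.

Lemma expmx_scaleE O d t : orthogonalmx O ->
  expmx (t *: (O^T *m diag_mx d *m O)) =
  O^T *m diag_mx (map_mx (fun x => expR (t * x)) d) *m O.
Proof.
move=> oO; rewrite scalemxAl scalemxAr -linearZ /= expmxE fcalcE//.
by congr (_ *m diag_mx _ *m _); apply/rowP => i; rewrite !mxE.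
Qed.

Lemma expmxD X s t : X^T = X ->
  expmx ((s + t) *: X) = expmx (s *: X) *m expmx (t *: X).
Proof.
move=> Xs; have [ O [d [oO ->]]] := real_spectral Xs.
rewrite !expmx_scaleE// !mulmxA -(mulmxA _ O) orthogonalmx_tr// mulmx1.
rewrite -[in RHS](mulmxA O^T) mulmx_diag; congr (_ *m diag_mx _ *m _).
by apply/rowP => i; rewrite !mxE mulrDl expRD.
Qed.

Lemma expmx0 : expmx 0 = 1%:M.
Proof.
have o1 : orthogonalmx (1%:M : 'M[R]_n) by rewrite /orthogonalmx trmx1 mulmx1.
have := expmx_scaleE 0 0 o1; rewrite scale0r => ->.
rewrite trmx1 mulmx1 mul1mx; apply/matrixP => i j.
by rewrite !mxE mul0r expR0.
Qed.

Lemma expmxN X : X^T = X -> expmx (- X) *m expmx X = 1%:M.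
Proof.
move=> Xs; have := expmxD (- 1) 1 Xs.
by rewrite addNr scale0r expmx0 scaleN1r scale1r => <-.
Qed.

Lemma expmx_posdef X : X^T = X -> posdefmx (expmx X).
Proof.
move=> Xs; split; first exact: expmx_sym.
move=> x x0; set Y := expmx (2^-1 *: X).
have -> : expmx X = Y^T *m Y.
  rewrite expmx_sym -expmxD// -div1r -splitr scale1r //.
have Yu : Y \in unitmx.
  suff /mulmx1_unit[] : expmx (- (2^-1 *: X)) *m Y = 1%:M by [].
  by apply: expmxN; rewrite linearZ /= Xs.
rewrite mulmxA -trmx_mul -mulmxA lt_neqAle -trace_mx11 sqnorm_ge0 andbT.
apply: contra x0 => /eqP/esym/sqnorm_eq0 /(congr1 (mulmx (invmx Y))).
by rewrite mulmxA mulVmx// mul1mx mulmx0 => ->.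
Qed.

Lemma expmx_SLP X : symm0 X -> SLP R n (expmx X).
Proof.
case=> Xs Xt; split; first exact: expmx_posdef.
have [ O [d [oO XE]]] := real_spectral Xs.
have := expmx_scaleE d 1 oO; rewrite -XE scale1r => ->.
rewrite det_orth_conj//; under eq_bigr do rewrite mxE mul1r.
by rewrite -expR_sum -(tr_orth_conj d oO) -XE Xt expR0.
Qed.

Lemma posdef_expmx A : posdefmx A -> exists2 X, X^T = X & A = expmx X.
Proof.
case=> As Apos; have [ O [d [oO AE]]] := real_spectral As.
have d0 i : 0 < d 0 i.
  have OO := orthogonalmx_tr oO.
  have v0 : O^T *m (delta_mx i 0 : 'cV[R]_n) != 0.
    apply/eqP => /(congr1 (mulmx O)); rewrite mulmxA OO mul1mx mulmx0.
    by move/matrixP/(_ i 0)/eqP; rewrite !mxE !eqxx oner_eq0.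
  have := Apos _ v0; rewrite AE trmx_mul trmxK !mulmxA -[_ *m O *m O^T]mulmxA OO.
  rewrite mulmx1 -[_ *m O *m O^T]mulmxA OO mulmx1 trmx_delta -rowE row_diag_mx.
  by rewrite -scalemxAl mul_delta_mx !mxE !eqxx mulr1.
exists (O^T *m diag_mx (map_mx (@ln R) d) *m O).
  by rewrite !trmx_mul trmxK tr_diag_mx mulmxA.
rewrite expmxE fcalcE// {1}AE; congr (_ *m diag_mx _ *m _).
by apply/rowP => i; rewrite !mxE lnK// posrE.
Qed.

Lemma SLP_expmx A : SLP R n A -> exists2 X, symm0 X & A = expmx X.
Proof.
case=> /posdef_expmx[X Xs ->] dX; exists X => //; split=> //.
have [ O [d [oO XE]]] := real_spectral Xs.
have := expmx_scaleE d 1 oO; rewrite -XE scale1r => EX; move: dX.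
rewrite EX det_orth_conj//; under eq_bigr do rewrite mxE mul1r.
rewrite -expR_sum -(tr_orth_conj d oO) -XE => /(congr1 (@ln R)).
by rewrite expRK ln1.
Qed.

Lemma expmx_comm X Y : X^T = X -> X *m Y = Y *m X ->
  expmx X *m Y = Y *m expmx X.
Proof. by rewrite expmxE; exact: fcalc_comm. Qed.

Lemma expmx_conj X Q : orthogonalmx Q -> X^T = X ->
  expmx (Q *m X *m Q^T) = Q *m expmx X *m Q^T.
Proof. by rewrite !expmxE; exact: fcalc_conj. Qed.

Lemma is_derive_mxP (V : normedModType R) p q (M : V -> 'M[R]_(p, q)) t v N :
  is_derive t v M N <-> forall i j, is_derive t v (fun x => M x i j) (N i j).
Proof.
split=> [[dM <-] i j|dM].
  have dMij := (derivable_mxP M t v).1 dM; split; first exact: dMij.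
  by rewrite derive_mx// mxE.
have dM' : derivable M t v by apply/derivable_mxP => i j; case: (dM i j).
split=> //; rewrite derive_mx//; apply/matrixP => i j; rewrite mxE.
by case: (dM i j).
Qed.

Lemma is_derive_mulmx (V : normedModType R) p q r (M : V -> 'M[R]_(p, q))
    (N : V -> 'M[R]_(q, r)) t v dM dN :
  is_derive t v M dM -> is_derive t v N dN ->
  is_derive t v (fun x => M x *m N x) (dM *m N t + M t *m dN).
Proof.
move=> /is_derive_mxP HM /is_derive_mxP HN; apply/is_derive_mxP => i j.
rewrite (_ : (fun x => _) =
    \sum_k ((fun x => M x i k) * (fun x => N x k j))); last first.
  by apply/funext => x; rewrite fct_sumE mxE.
apply: is_derive_eq; rewrite !mxE -big_split /=; apply: eq_bigr => k _.
by rewrite addrC; congr (_ + _); exact: mulrC.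
Qed.
End FunctionalCalculus.

(** * Line projections, their commutants and double commutants *)

Section RankOne.
Variables (R : realType) (n : nat).
Implicit Types (u v w : 'cV[R]_n) (M X Y Z Q : 'M[R]_n) (a b c : R).

Definition dot u v : R := (u^T *m v) 0 0.
Definition outer u v : 'M[R]_n := u *m v^T.

Lemma dotE u v : u^T *m v = (dot u v)%:M.
Proof. exact: mx11_scalar. Qed.

Lemma dotC u v : dot u v = dot v u.
Proof. by rewrite /dot -[u^T *m v]trmxK trmx_mul trmxK mxE. Qed.

Lemma dotDr u v w : dot u (v + w) = dot u v + dot u w.
Proof. by rewrite /dot mulmxDr mxE. Qed.

Lemma dotDl u v w : dot (u + v) w = dot u w + dot v w.
Proof. by rewrite !(dotC _ w) dotDr. Qed.

Lemma dotZr u a v : dot u (a *: v) = a * dot u v.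
Proof. by rewrite /dot -scalemxAr mxE. Qed.

Lemma dotZl u a v : dot (a *: u) v = a * dot u v.
Proof. by rewrite dotC dotZr dotC. Qed.

Lemma dotBr u v w : dot u (v - w) = dot u v - dot u w.
Proof. by rewrite /dot mulmxBr !mxE. Qed.

Lemma dot0r u : dot u 0 = 0.
Proof. by rewrite /dot mulmx0 mxE. Qed.

Lemma dot0l u : dot 0 u = 0.
Proof. by rewrite dotC dot0r. Qed.

Lemma dot_mulmx u M v : dot u (M *m v) = dot (M^T *m u) v.
Proof. by rewrite /dot trmx_mul trmxK mulmxA. Qed.

Lemma dot_ge0 v : 0 <= dot v v.
Proof. by rewrite /dot -trace_mx11 sqnorm_ge0. Qed.

Lemma dot_eq0 v : dot v v = 0 -> v = 0.
Proof. by rewrite /dot -trace_mx11; exact: sqnorm_eq0. Qed.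

Lemma tr_outer u v : (outer u v)^T = outer v u.
Proof. by rewrite /outer trmx_mul trmxK. Qed.

Lemma mxtrace_outer u v : \tr (outer u v) = dot v u.
Proof. by rewrite /outer mxtrace_mulC trace_mx11. Qed.

Lemma outer_mul u v w : outer u v *m w = dot v w *: u.
Proof. by rewrite /outer -mulmxA dotE mul_mx_scalar. Qed.

Lemma mulmx_outer M u v : M *m outer u v = outer (M *m u) v.
Proof. by rewrite /outer mulmxA. Qed.

Lemma outer_mulmx M u v : outer u v *m M = outer u (M^T *m v).
Proof. by rewrite /outer trmx_mul trmxK mulmxA. Qed.

Lemma outerZl a u v : outer (a *: u) v = a *: outer u v.
Proof. by rewrite /outer -scalemxAl. Qed.

Lemma outerZr a u v : outer u (a *: v) = a *: outer u v.
Proof. by rewrite -tr_outer outerZl linearZ /= tr_outer. Qed.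

Lemma outerDl u v w : outer (u + v) w = outer u w + outer v w.
Proof. by rewrite /outer mulmxDl. Qed.

Lemma outerDr u v w : outer u (v + w) = outer u v + outer u w.
Proof. by rewrite -tr_outer outerDl linearD /= !tr_outer. Qed.

Lemma outerM u v w x : outer u v *m outer w x = dot v w *: outer u x.
Proof. by rewrite mulmx_outer outer_mul outerZl. Qed.

Lemma outer0l v : outer 0 v = 0.
Proof. by rewrite /outer mul0mx. Qed.

Lemma outer0r v : outer v 0 = 0.
Proof. by rewrite /outer trmx0 mulmx0. Qed.

Lemma normalize v : v != 0 -> exists2 c, c != 0 & dot (c *: v) (c *: v) = 1.
Proof.
move=> v0; have d0 : 0 < dot v v.
  by rewrite lt_neqAle dot_ge0 andbT eq_sym; apply: contra v0 => /eqP/dot_eq0 ->.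
exists (Num.sqrt (dot v v))^-1; first by rewrite invr_eq0 sqrtr_eq0 -ltNge.
by rewrite dotZr dotZl mulrA -invfM -expr2 sqr_sqrtr ?ltW// mulVf// gt_eqF.
Qed.

Lemma exists_orthogonal k (M : 'M[R]_(k, n)) : (k < n)%N ->
  exists2 w : 'cV[R]_n, dot w w = 1 & M *m w = 0.
Proof.
move=> kn; have : kermx M^T != 0.
  rewrite kermx_eq0 /row_free mxrank_tr; apply/eqP => rM.
  by have := rank_leq_row M; rewrite rM leqNgt kn.
move=> /rowV0Pn[x /sub_kermxP xM x0].
have [|c c0 cx] := @normalize x^T; first by rewrite trmx_eq0.
exists (c *: x^T) => //.
by rewrite -scalemxAr -[M *m _]trmxK trmx_mul trmxK xM trmx0 scaler0.
Qed.

Lemma exists_orthogonal1 v : (1 < n)%N -> exists2 w, dot w w = 1 & dot v w = 0.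
Proof.
move=> n1; have [w w1 vw] := exists_orthogonal v^T n1.
by exists w => //; rewrite /dot vw mxE.
Qed.

Lemma exists_orthogonal2 u v : (2 < n)%N ->
  exists2 w, dot w w = 1 & dot u w = 0 /\ dot v w = 0.
Proof.
move=> n2; have [w w1 vw] := @exists_orthogonal (1 + 1) (col_mx u^T v^T) n2.
exists w => //; move: vw; rewrite mul_col_mx => /eqP; rewrite col_mx_eq0.
by move=> /andP[/eqP uw /eqP vw]; rewrite /dot uw vw mxE.
Qed.

Lemma eq_mulcV (M N : 'M[R]_n) : (forall x : 'cV[R]_n, M *m x = N *m x) -> M = N.
Proof.
move=> MN; apply/matrixP => i j.
by have /matrixP/(_ i 0) := MN (delta_mx j 0); rewrite -!colE !mxE.
Qed.

Lemma nonzero_mulcV M : M != 0 -> exists x : 'cV[R]_n, M *m x != 0.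
Proof.
move=> M0; apply: contrapT => h; move/eqP: M0; apply; apply: eq_mulcV => x.
rewrite mul0mx; apply: contrapT => /eqP Mx; apply: h; by exists x.
Qed.

Lemma projection_fixed_vector Q : Q^T = Q -> Q *m Q = Q -> Q != 0 ->
  exists2 u, dot u u = 1 & Q *m u = u.
Proof.
move=> Qs QQ /nonzero_mulcV[x Qx]; have [c c0 cx] := normalize Qx.
by exists (c *: (Q *m x)) => //; rewrite -scalemxAr mulmxA QQ.
Qed.

(** Removing a fixed line from a projection leaves a projection, which is zero or
    has a fixed line of its own. *)
Lemma projection_two_fixed_vectors Q : Q^T = Q -> Q *m Q = Q -> Q != 0 ->
  (exists2 u, dot u u = 1 & Q = outer u u) \/
  exists u v, [/\ dot u u = 1, dot v v = 1, dot u v = 0, Q *m u = u & Q *m v = v].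
Proof.
move=> Qs QQ Q0; have [u u1 Qu] := projection_fixed_vector Qs QQ Q0.
have [Qe|Qn] := eqVneq (Q - outer u u) 0.
  by left; exists u => //; apply/eqP; rewrite -subr_eq0 Qe.
have uQ : outer u u *m Q = outer u u by rewrite outer_mulmx Qs Qu.
right; have [|||v v1 Qv] := @projection_fixed_vector (Q - outer u u) => //.
- by rewrite linearB /= Qs tr_outer.
- rewrite mulmxBl !mulmxBr QQ outerM u1 scale1r uQ mulmx_outer Qu.
  by rewrite subrr subr0.
have uv : dot u v = 0.
  by rewrite -Qv mulmxBl outer_mul dotBr dotZr u1 dot_mulmx Qs Qu mulr1 subrr.
exists u, v; split=> //; move: Qv.
by rewrite mulmxBl outer_mul uv scale0r subr0.
Qed.

Hypothesis n1 : (1 < n)%N.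

Let n0 : n%:R != 0 :> R.
Proof. by rewrite pnatr_eq0 -lt0n ltnW. Qed.

(** The traceless part of the orthogonal projection on a line. *)
Definition line0 v : 'M[R]_n := outer v v - (n%:R^-1)%:M.

Lemma line0_symm0 v : dot v v = 1 -> symm0 (line0 v).
Proof.
move=> v1; split; rewrite /line0 linearB /= ?tr_outer ?tr_scalar_mx//.
by rewrite mxtrace_outer v1 mxtrace_scalar -[_ *+ n]mulr_natr mulVf// subrr.
Qed.

Lemma tr_line0M v M : \tr M = 0 -> \tr (line0 v *m M) = dot v (M *m v).
Proof.
move=> M0; rewrite /line0 mulmxBl mul_scalar_mx linearB linearZ /= M0 mulr0 subr0.
by rewrite outer_mulmx mxtrace_outer -dot_mulmx.
Qed.

Lemma dot_line0 u v : dot v v = 1 -> dot u u = 1 ->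
  \tr (line0 u *m line0 v) = dot u v ^+ 2 - n%:R^-1.
Proof.
move=> v1 u1; rewrite tr_line0M; last exact: (line0_symm0 v1).2.
rewrite /line0 mulmxBl outer_mul mul_scalar_mx dotBr !dotZr u1 (dotC v).
by rewrite mulr1 expr2.
Qed.

Lemma line0_comm v Z : line0 v *m Z = Z *m line0 v <->
  outer v v *m Z = Z *m outer v v.
Proof.
rewrite /line0 mulmxBl mulmxBr mul_scalar_mx mul_mx_scalar.
by split=> [/addIr//|->].
Qed.

(** The double commutant of a line projection is spanned by it and the
    identity: every vector orthogonal to [v] is an eigenvector of [Y]. *)
Lemma line0_bicommutant v Y : dot v v = 1 -> symm0 Y ->
  (forall Z, symm0 Z -> line0 v *m Z = Z *m line0 v -> Y *m Z = Z *m Y) ->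
  exists a, Y = a *: line0 v.
Proof.
move=> v1 [Ys Yt] H.
have eig w : dot v w = 0 \/ w = v -> dot w w *: (Y *m w) = dot w (Y *m w) *: w.
  move=> vw; pose Z := outer w w - (dot w w / n%:R)%:M.
  have Zs : symm0 Z.
    split; rewrite /Z linearB /= ?tr_outer ?tr_scalar_mx//.
    by rewrite mxtrace_outer mxtrace_scalar -[_ *+ n]mulr_natr divfK// subrr.
  have /(H Z Zs) : line0 v *m Z = Z *m line0 v.
    apply/line0_comm; rewrite /Z mulmxBl mulmxBr mul_scalar_mx mul_mx_scalar.
    congr (_ - _); rewrite !outerM.
    by case: vw => [vw|->]//; rewrite (dotC w) vw !scale0r.
  rewrite /Z mulmxBl mulmxBr mul_scalar_mx mul_mx_scalar => /addIr.
  move=> /(congr1 (mulmx^~ w)) /=; rewrite -(mulmxA Y) -(mulmxA (outer w w)) !outer_mul.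
  by rewrite -scalemxAr.
have [w0 w01 vw0] := exists_orthogonal1 v n1.
pose al := dot w0 (Y *m w0).
have Yw0 : Y *m w0 = al *: w0 by have := eig w0 (or_introl vw0); rewrite w01 scale1r.
have w0Y w : dot w0 (Y *m w) = al * dot w0 w by rewrite dot_mulmx Ys Yw0 dotZl.
have Yperp w : dot v w = 0 -> Y *m w = al *: w.
  move=> vw; have [->|wn0] := eqVneq w 0; first by rewrite mulmx0 scaler0.
  have dw : dot w w != 0 by apply: contra wn0 => /eqP/dot_eq0 ->.
  have Ew := eig w (or_introl vw).
  have [w0w|w0w] := eqVneq (dot w0 w) 0.
    have vww : dot v (w + w0) = 0 by rewrite dotDr vw vw0 addr0.
    have := eig _ (or_introl vww); set s := dot (w + w0) (w + w0).
    set m := dot (w + w0) _ => E.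
    have s0 : s != 0.
      by rewrite /s dotDl !dotDr w01 w0w dotC w0w addr0 add0r gt_eqF// ltr_wpDl// dot_ge0.
    have mE : m = s * al.
      move: (congr1 (dot w0) E); rewrite !dotZr w0Y dotDr w0w w01 add0r !mulr1.
      by move=> <-.
    move: E; rewrite mE -scalerA => /(scalerI s0).
    by rewrite mulmxDr Yw0 scalerDr => /addIr.
  have mE : dot w (Y *m w) = dot w w * al.
    apply: (mulIf w0w); move: (congr1 (dot w0) Ew); rewrite !dotZr w0Y => <-.
    by rewrite mulrA.
  by move: Ew; rewrite mE -scalerA => /(scalerI dw).
pose be := dot v (Y *m v).
have Yv : Y *m v = be *: v by have := eig v (or_intror erefl); rewrite v1 scale1r.
have YE : Y = al%:M + (be - al) *: outer v v.
  apply: eq_mulcV => x; rewrite mulmxDl mul_scalar_mx -scalemxAl outer_mul.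
  have -> : Y *m x = Y *m (x - dot v x *: v) + dot v x *: (Y *m v).
    by rewrite mulmxBr -scalemxAr subrK.
  rewrite Yv Yperp; last by rewrite dotBr dotZr v1 mulr1 subrr.
  rewrite scalerBr !scalerA -addrA; congr (_ + _); rewrite -scaleNr -scalerDl.
  by congr (_ *: _); ring.
exists (be - al); rewrite /line0 scalerBr scale_scalar_mx.
have : \tr Y = 0 by [].
rewrite {1}YE linearD linearZ /= mxtrace_scalar mxtrace_outer v1 mulr1 => t0.
have alE : al = - ((be - al) * n%:R^-1).
  apply: (mulIf n0); rewrite mulNr mulfVK//; apply/eqP; rewrite -subr_eq0 opprK.
  by rewrite mulr_natr t0.
by rewrite {1}YE addrC -[in RHS]raddfN /= -alE.
Qed.

(** The orthogonal complement of the commutant of a line projection: the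
    tangent space of projective space at that line. *)
Lemma line0_commutant_perp v M : dot v v = 1 -> symm0 M ->
  (forall Z, symm0 Z -> line0 v *m Z = Z *m line0 v -> \tr (M *m Z) = 0) ->
  exists2 w, dot v w = 0 & M = outer v w + outer w v.
Proof.
move=> v1 [Ms Mt] H; pose q := outer v v; pose p := 1%:M - q.
have qq : q *m q = q by rewrite /q outerM v1 scale1r.
have pq : p *m q = 0 by rewrite /p mulmxBl mul1mx qq subrr.
have qp : q *m p = 0 by rewrite /p mulmxBr mulmx1 qq subrr.
have pp : p *m p = p by rewrite {1}/p mulmxBl mul1mx qp subr0.
have qs : q^T = q by rewrite /q tr_outer.
have ps : p^T = p by rewrite /p linearB /= trmx1 qs.
have qMq : q *m M *m q = dot v (M *m v) *: q.
  by rewrite -mulmxA mulmx_outer outerM.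
set m := dot v (M *m v) in qMq.
pose N := p *m M *m p.
have Ns : N^T = N by rewrite /N !trmx_mul ps Ms mulmxA.
have pN : p *m N = N by rewrite /N !mulmxA pp.
have Np : N *m p = N by rewrite /N -mulmxA pp.
have tN : \tr (M *m N) = \tr (N^T *m N).
  have -> : N^T *m N = p *m (M *m N).
    by rewrite Ns {1}/N -[p *m M *m p *m N]mulmxA pN mulmxA.
  by rewrite [RHS]mxtrace_mulC -mulmxA Np.
have tq : \tr (M *m q) = m by rewrite mulmx_outer mxtrace_outer.
have tN0 : \tr N = - m.
  rewrite /N mxtrace_mulC mulmxA pp mxtrace_mulC /p mulmxBr mulmx1 linearB /= Mt tq.
  by rewrite sub0r.
(* Pairing [M] with [Z] gives the sum of the squared norms of the two diagonal
   blocks [N] and [m *: q] of [M]. *)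
pose Z := N + m *: q.
have Zs : symm0 Z.
  split; first by rewrite /Z linearD linearZ /= Ns qs.
  by rewrite /Z linearD linearZ /= tN0 mxtrace_outer v1 mulr1 addNr.
have /(H Z Zs) : line0 v *m Z = Z *m line0 v.
  apply/line0_comm; rewrite /Z mulmxDl mulmxDr -scalemxAl -scalemxAr.
  by rewrite -/q /N !mulmxA qp mul0mx mul0mx -!mulmxA pq !mulmx0.
rewrite /Z mulmxDr -scalemxAr linearD linearZ /= tN tq -expr2 => /eqP.
rewrite paddr_eq0 ?sqnorm_ge0 ?sqr_ge0// sqrf_eq0 => /andP[/eqP/sqnorm_eq0 N0 /eqP m0].
exists (p *m M *m v); first by rewrite -!mulmxA dot_mulmx ps /p mulmxBl mul1mx
  outer_mul v1 scale1r subrr dot0l.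
have sandwich (a b : 'M[R]_n) :
    (a + b) *m M *m (a + b) = a *m M *m a + b *m M *m a + (a *m M *m b + b *m M *m b).
  by rewrite mulmxDl mulmxDr !mulmxDl.
have {1}-> : M = (p + q) *m M *m (p + q) by rewrite /p subrK mul1mx mulmx1.
rewrite sandwich -[p *m M *m p]/N N0 qMq m0 scale0r add0r addr0.
congr (_ + _); last by rewrite mulmx_outer.
by rewrite -mulmxA outer_mulmx trmx_mul ps Ms.
Qed.

End RankOne.

(** * Images of line projections under isometries preserving commutation *)

Section Quadratic.
Variables (R : realType) (n : nat).

(** As the product [- b] of the roots of the polynomial is negative, the roots
    are real and distinct, and [Q] projects on the eigenspace of the larger. *)
Lemma quadratic_projection (X : 'M[R]_n) a b : X^T = X -> 0 < b ->
  X *m X = a *: X + b%:M ->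
  exists (q c : R) (Q : 'M[R]_n),
    [/\ c != 0, Q^T = Q, Q *m Q = Q & X = q%:M + c *: Q].
Proof.
move=> Xs b0 XX; pose D := Num.sqrt (a ^+ 2 + 4 * b).
have DD : D ^+ 2 = a ^+ 2 + 4 * b.
  by rewrite sqr_sqrtr// addr_ge0 ?sqr_ge0// mulr_ge0// ltW.
have D0 : D != 0.
  by rewrite -(sqrf_eq0 D) DD gt_eqF// ltr_wpDl ?sqr_ge0// mulr_gt0.
pose q := (a - D) / 2.
exists q, D, (D^-1 *: (X - q%:M)); split=> //.
- by rewrite linearZ linearB /= Xs tr_scalar_mx.
- rewrite -scalemxAl -scalemxAr scalerA mulmxBl !mulmxBr XX.
  rewrite mul_scalar_mx !mul_mx_scalar scale_scalar_mx.
  have -> : a *: X + b%:M - q *: X - (q *: X - (q * q)%:M) = D *: (X - q%:M).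
    rewrite scalerBr scale_scalar_mx; apply/matrixP => i j.
    rewrite !mxE -(mulr_natr b) -(mulr_natr (q * q)) -(mulr_natr (D * q)).
    have -> : a = D + 2 * q by rewrite /q; field.
    have -> : b = D * - q - q * q by have := DD; rewrite /q => DDE; lra.
    by ring.
  by rewrite scalerA -mulrA mulVf// mulr1.
- by rewrite scalerA mulfV// scale1r addrC subrK.
Qed.
End Quadratic.

Section Isometry.
Variables (R : realType) (n : nat) (L : {linear 'M[R]_n -> 'M[R]_n}).
Hypothesis n1 : (1 < n)%N.
Hypothesis Ls : forall X, symm0 X -> symm0 (L X).
Hypothesis Liso : forall X Y, symm0 X -> symm0 Y -> \tr (L X *m L Y) = \tr (X *m Y).
Hypothesis Lonto : forall Y, symm0 Y -> exists2 X, symm0 X & L X = Y.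
Hypothesis Lcomm : forall X Y, symm0 X -> symm0 Y ->
  X *m Y = Y *m X <-> L X *m L Y = L Y *m L X.
Implicit Types (u v w : 'cV[R]_n) (X Y Z : 'M[R]_n).

Let n0 : n%:R != 0 :> R.
Proof. by rewrite pnatr_eq0 -lt0n ltnW. Qed.

Let kap_gt0 : 0 < 1 - n%:R^-1 :> R.
Proof. by rewrite subr_gt0 invf_lt1 ?ltr1n// ltr0n ltnW. Qed.

(** The square of [L (line0 v)], made traceless, commutes with whatever commutes
    with [L (line0 v)]. Pulled back by [L] it belongs to the double commutant of
    [line0 v], so it is a multiple of [L (line0 v)]. *)
Lemma image_line0_quadratic v : dot v v = 1 ->
  exists a, exists2 b, 0 < b &
    L (line0 v) *m L (line0 v) = a *: L (line0 v) + b%:M.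
Proof.
move=> v1; have Vs := line0_symm0 n1 v1; set V := L (line0 v).
have [Vts Vt0] : symm0 V := Ls Vs.
have VV : \tr (V *m V) = 1 - n%:R^-1 by rewrite Liso// dot_line0// v1 expr1n.
pose b := (1 - n%:R^-1) / n%:R :> R; pose Y := V *m V - b%:M.
have Ys : symm0 Y.
  split; first by rewrite /Y linearB /= trmx_mul Vts tr_scalar_mx.
  by rewrite /Y linearB /= VV mxtrace_scalar -[b *+ n]mulr_natr divfK// subrr.
have YV Z : V *m Z = Z *m V -> Y *m Z = Z *m Y.
  move=> VZ; rewrite /Y mulmxBl mulmxBr mul_scalar_mx mul_mx_scalar.
  by congr (_ - _); rewrite -mulmxA VZ mulmxA VZ mulmxA.
have [M Ms LM] := Lonto Ys.
have [|a ME] := line0_bicommutant n1 v1 Ms.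
  move=> Z Zs vZ; apply/(Lcomm Ms Zs); rewrite LM; apply: YV.
  exact/(Lcomm Vs Zs).
exists a, b; first by rewrite divr_gt0// ltr0n ltnW.
by apply/eqP; rewrite -subr_eq -/Y -LM ME linearZ.
Qed.

(** Orthogonality and commutation are both preserved by [L], so the orthogonal
    complement of the commutant is transported by [L] as well. *)
Lemma image_line0_commutant_perp v Y : dot v v = 1 -> symm0 Y ->
  (forall Z, L (line0 v) *m Z = Z *m L (line0 v) -> \tr (Y *m Z) = 0) ->
  exists2 w, dot v w = 0 & Y = L (outer v w + outer w v) /\ symm0 (outer v w + outer w v).
Proof.
move=> v1 Ys H; have [M Ms LM] := Lonto Ys.
have [|w vw ME] := line0_commutant_perp v1 Ms.
  move=> Z Zs vZ; rewrite -(Liso Ms Zs) LM; apply: H.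
  exact/(Lcomm (line0_symm0 n1 v1) Zs).
by exists w => //; rewrite -ME.
Qed.

(** Two orthonormal pairs, one in the range and one in the kernel of a
    projection, give two commuting orthogonal elements of the complement of the
    commutant; for a line projection no such elements exist. *)
Lemma image_line0_projection_rank v q c (Q : 'M[R]_n) u1 u2 u3 u4 :
  dot v v = 1 -> L (line0 v) = q%:M + c *: Q -> c != 0 -> Q^T = Q ->
  Q *m u1 = u1 -> Q *m u2 = u2 -> Q *m u3 = 0 -> Q *m u4 = 0 ->
  dot u1 u1 = 1 -> dot u2 u2 = 1 -> dot u3 u3 = 1 -> dot u4 u4 = 1 ->
  dot u1 u2 = 0 -> dot u3 u4 = 0 -> False.
Proof.
move=> v1 LE c0 Qs Q1 Q2 Q3 Q4 d1 d2 d3 d4 d12 d34.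
have perp a b : Q *m a = a -> Q *m b = 0 -> dot a b = 0.
  by move=> Qa Qb; rewrite -Qa -{1}Qs -dot_mulmx Qb dot0r.
pose Y (a b : 'cV[R]_n) := outer a b + outer b a.
have YP a b : Q *m a = a -> Q *m b = 0 ->
    exists2 w, dot v w = 0 & Y a b = L (Y v w) /\ symm0 (Y v w).
  move=> Qa Qb; apply: image_line0_commutant_perp => //.
    split; first by rewrite linearD /= !tr_outer addrC.
    by rewrite linearD /= !mxtrace_outer dotC (perp a b)// addr0.
  move=> Z; rewrite LE mulmxDl mulmxDr mul_scalar_mx mul_mx_scalar => /addrI.
  rewrite -scalemxAl -scalemxAr => /(scalerI c0) QZ.
  rewrite mulmxDl linearD /= !outer_mulmx !mxtrace_outer -!dot_mulmx.
  have -> : dot b (Z *m a) = 0.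
    rewrite -Qa mulmxA -QZ -mulmxA dot_mulmx Qs Qb.
    by rewrite dot0l.
  rewrite -Qa -{1}Qs -dot_mulmx mulmxA QZ -mulmxA Qb mulmx0.
  by rewrite dot0r addr0.
have [w1 vw1 [Y1 s1]] := YP _ _ Q1 Q3; have [w2 vw2 [Y2 s2]] := YP _ _ Q2 Q4.
have YM a b a' b' : Y a b *m Y a' b' =
    dot b a' *: outer a b' + dot b b' *: outer a a' +
    (dot a a' *: outer b b' + dot a b' *: outer b a').
  by rewrite /Y mulmxDl !mulmxDr !outerM.
have e14 := perp _ _ Q1 Q4; have e23 := perp _ _ Q2 Q3.
have Y12 : Y u1 u3 *m Y u2 u4 = 0.
  by rewrite YM (dotC u3 u2) e23 d34 d12 e14 !scale0r !addr0.
have Y21 : Y u2 u4 *m Y u1 u3 = 0.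
  by rewrite YM (dotC u4) e14 (dotC u4) d34 (dotC u2) d12 e23 !scale0r !addr0.
have : dot w1 w2 = 0.
  have : \tr (Y v w1 *m Y v w2) = 0 by rewrite -Liso// -Y1 -Y2 Y12 mxtrace0.
  rewrite YM (dotC w1) vw1 vw2 v1 !scale0r !add0r addr0 scale1r linearD linearZ /=.
  rewrite !mxtrace_outer v1 mulr1 (dotC w2) -mulr2n => /eqP.
  by rewrite mulrn_eq0 => /eqP.
move=> w12.
have ow : outer w1 w2 = outer w2 w1.
  have /(Lcomm s1 s2) : L (Y v w1) *m L (Y v w2) = L (Y v w2) *m L (Y v w1).
    by rewrite -Y1 -Y2 Y12 Y21.
  rewrite !YM (dotC w1 v) (dotC w2 v) vw1 vw2 (dotC w2) w12 v1.
  by rewrite !scale0r !add0r !addr0 !scale1r.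
have Y0 a b w : dot a b = 0 -> dot a a = 1 -> dot b b = 1 -> w = 0 ->
    Y a b = L (Y v w) -> False.
  move=> ab aa bb w0; rewrite /Y w0 outer0l outer0r addr0 linear0 => Yab.
  have := YM a b a b; rewrite /Y Yab mul0mx (dotC b) ab aa bb !scale0r addr0 add0r.
  move=> /(congr1 mxtrace); rewrite mxtrace0 linearD /= !scale1r !mxtrace_outer aa bb.
  by move=> /eqP; rewrite eq_sym -mulr2n mulrn_eq0 oner_eq0.
have := congr1 (mulmx^~ w2) ow; rewrite !outer_mul w12 scale0r => /eqP.
rewrite scaler_eq0 => /orP[/eqP/dot_eq0|/eqP] w0.
- by apply: Y0 Y2 => //; exact: perp.
- by apply: Y0 Y1 => //; exact: perp.
Qed.

(** The quadratic equation gives two complementary spectral projections, the rank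
    argument makes one of them a line projection, and the norm fixes the scalar
    factor up to sign. *)
Lemma image_line0 v : dot v v = 1 ->
  exists (e : R) w, [/\ e ^+ 2 = 1, dot w w = 1 & L (line0 v) = e *: line0 w].
Proof.
move=> v1; have Vs := line0_symm0 n1 v1.
have [a [b b0 Vquad]] := image_line0_quadratic v1.
have [VT Vt] := Ls Vs.
have VV : \tr (L (line0 v) *m L (line0 v)) = 1 - n%:R^-1.
  by rewrite Liso// dot_line0// v1 expr1n.
have [q [c [Q [c0 Qs QQ VE]]]] := quadratic_projection VT b0 Vquad.
have fin r w : dot w w = 1 -> (exists p, L (line0 v) = p%:M + r *: outer w w) ->
    exists (e : R) w, [/\ e ^+ 2 = 1, dot w w = 1 & L (line0 v) = e *: line0 w].
  move=> w1 [p pE]; exists r, w.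
  have LE : L (line0 v) = r *: line0 w.
    have : \tr (L (line0 v)) = 0 by [].
    rewrite pE linearD linearZ /= mxtrace_scalar mxtrace_outer w1 mulr1 => pr.
    have -> : p = - (r / n%:R).
      apply: (mulIf n0); rewrite mulNr divfK// mulr_natr; apply/eqP.
      by rewrite -addr_eq0 pr.
    by rewrite /line0 scalerBr scale_scalar_mx addrC raddfN.
  split=> //; move: VV; rewrite LE -scalemxAl -scalemxAr scalerA linearZ /=.
  rewrite dot_line0// w1 expr1n -{2}[1 - _]mul1r -expr2 => /mulIf -> //.
  by rewrite gt_eqF.
have Vne (r : R) : L (line0 v) = r%:M -> False.
  move=> Lr; move: Vt VV; rewrite Lr mxtrace_scalar -[r *+ n]mulr_natr => /eqP.
  rewrite mulf_eq0 (negbTE n0) orbF => /eqP->.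
  by rewrite mul_scalar_mx scale0r mxtrace0 => k0; move: kap_gt0; rewrite -k0 ltxx.
pose P := 1%:M - Q.
have Ps : P^T = P by rewrite /P linearB /= trmx1 Qs.
have PP : P *m P = P by rewrite /P mulmxBl !mulmxBr mulmx1 mul1mx QQ mulmx1 subrr subr0.
have Q0 : Q != 0 by apply/eqP => Q0; apply: (Vne q); rewrite VE Q0 scaler0 addr0.
have P0 : P != 0.
  apply/eqP => P0; apply: (Vne (q + c)); rewrite VE.
  have -> : Q = 1%:M by apply/eqP; rewrite eq_sym -subr_eq0 -/P P0.
  by rewrite scale_scalar_mx mulr1 -raddfD.
have [[w w1 QE]|[u1 [u2 [d1 d2 d12 Q1 Q2]]]] := projection_two_fixed_vectors Qs QQ Q0.
  by apply: (fin c w) => //; exists q; rewrite VE QE.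
have [[w w1 PE]|[u3 [u4 [d3 d4 d34 P3 P4]]]] := projection_two_fixed_vectors Ps PP P0.
  apply: (fin (- c) w) => //; exists (q + c).
  rewrite -PE /P scaleNr scalerBr opprB VE addrA raddfD /=.
  by rewrite scale_scalar_mx mulr1 [in RHS]addrAC addrK.
exfalso; have PQ (x : 'cV[R]_n) : P *m x = x -> Q *m x = 0.
  by rewrite /P mulmxBl mul1mx => /eqP; rewrite subr_eq -subr_eq0 opprD addNKr
   oppr_eq0 => /eqP.
exact: (image_line0_projection_rank v1 VE c0 Qs Q1 Q2 (PQ u3 P3) (PQ u4 P4)
  d1 d2 d3 d4 d12 d34).
Qed.
End Isometry.

(** * Classification of isometries preserving commutation *)

(** A linear isometry fixing the coordinate line projections and mapping line
    projections to line projections is a conjugation by a diagonal matrix of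
    signs: it preserves the diagonal entries of every matrix and changes each
    off-diagonal entry by a sign, and these signs form a rank-one matrix because
    they are the signs of the entries of the image of the line spanned by
    [(1, ..., 1)]. *)
Section SignedDiagonal.
Variables (R : realType) (n : nat) (T : 'M[R]_n -> 'M[R]_n).
Hypothesis n1 : (1 < n)%N.
Hypothesis TD : forall X Y, T (X + Y) = T X + T Y.
Hypothesis TZ : forall (a : R) X, T (a *: X) = a *: T X.
Hypothesis Ts : forall X, symm0 X -> symm0 (T X).
Hypothesis Tiso : forall X Y, symm0 X -> symm0 Y -> \tr (T X *m T Y) = \tr (X *m Y).
Let ev (i : 'I_n) : 'cV[R]_n := delta_mx i 0.
Hypothesis Te : forall i, T (line0 (ev i)) = line0 (ev i).
Hypothesis Tv : forall v, dot v v = 1 -> exists2 w, dot w w = 1 & T (line0 v) = line0 w.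

Let n0 : n%:R != 0 :> R.
Proof. by rewrite pnatr_eq0 -lt0n ltnW. Qed.

Let dot_evr i (v : 'cV[R]_n) : dot v (ev i) = v i 0.
Proof. by rewrite /dot -colE !mxE. Qed.

Let dot_ev i j : dot (ev i) (ev j) = (i == j)%:R.
Proof. by rewrite dot_evr mxE eqxx andbT eq_sym. Qed.

Let ev1 i : dot (ev i) (ev i) = 1.
Proof. by rewrite dot_ev eqxx. Qed.

Let T_diag X i : symm0 X -> T X i i = X i i.
Proof.
move=> Xs; have entry M : \tr M = 0 -> M i i = \tr (line0 (ev i) *m M).
  by move=> M0; rewrite tr_line0M// dotC dot_evr -colE mxE.
rewrite !entry; [|exact: Xs.2|exact: (Ts Xs).2].
by rewrite -{1}Te Tiso//; exact: line0_symm0.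
Qed.

Let line0_entry (v : 'cV[R]_n) i j : line0 v i j = v i 0 * v j 0 - n%:R^-1 *+ (i == j).
Proof. by rewrite !mxE big_ord1 !mxE. Qed.

Let T_line0_sqr v w i : dot v v = 1 -> T (line0 v) = line0 w ->
  w i 0 ^+ 2 = v i 0 ^+ 2.
Proof.
move=> v1 Tvw; have := T_diag i (line0_symm0 n1 v1); rewrite Tvw !line0_entry.
by move/addIr; rewrite -!expr2.
Qed.

Let S i j : 'M[R]_n := outer (ev i) (ev j) + outer (ev j) (ev i).

Let T_S i j : i != j -> exists2 s, s ^+ 2 = 1 & T (S i j) = s *: S i j.
Proof.
move=> ij; have ji : j != i by rewrite eq_sym.
pose c : R := Num.sqrt 2^-1.
have cc : c * c = 2^-1 by rewrite -expr2 sqr_sqrtr// invr_ge0.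
pose u := c *: (ev i + ev j).
have u1 : dot u u = 1.
  rewrite dotZl dotZr mulrA cc dotDl !dotDr !ev1 !dot_ev (negbTE ij) (negbTE ji).
  by rewrite add0r addr0 mulrDr mulr1 -div1r -splitr.
have SE : S i j = 2 *: line0 u - (line0 (ev i) + line0 (ev j)).
  rewrite /S /line0 /u outerZl outerZr scalerA cc outerDl !outerDr.
  move: (outer _ _) (outer _ _) (outer _ _) (outer _ _) _%:M => A B B' C K.
  by apply/matrixP => k l; rewrite !mxE; field.
have [w w1 Tw] := Tv u1.
have wk k : w k 0 ^+ 2 = 2^-1 * ((k == i)%:R + (k == j)%:R) ^+ 2.
  by rewrite (T_line0_sqr k u1 Tw) !mxE !eqxx !andbT exprMn expr2 cc.
have wi : w i 0 * w i 0 = 2^-1.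
  by rewrite -expr2 wk eqxx (negbTE ij) addr0 expr1n mulr1.
have wj : w j 0 * w j 0 = 2^-1.
  by rewrite -expr2 wk eqxx (negbTE ji) add0r expr1n mulr1.
have wE : w = w i 0 *: ev i + w j 0 *: ev j.
  apply/colP => k; rewrite !mxE !eqxx !andbT.
  have [->|ki] := eqVneq k i; first by rewrite (negbTE ij) mulr1 mulr0 addr0.
  have [->|kj] := eqVneq k j; first by rewrite mulr1 mulr0 add0r.
  rewrite !mulr0 addr0; apply/eqP; rewrite -sqrf_eq0 wk (negbTE ki) (negbTE kj).
  by rewrite addr0 expr0n mulr0.
exists (2 * (w i 0 * w j 0)).
  by rewrite exprMn exprMn !expr2 wi wj; field.
have -> : T (S i j) = 2 *: line0 w - (line0 (ev i) + line0 (ev j)).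
  by rewrite {1}SE TD -scaleN1r !TZ TD !Te Tw scaleN1r.
have -> : line0 w = 2^-1 *: outer (ev i) (ev i) + 2^-1 *: outer (ev j) (ev j)
    + (w i 0 * w j 0) *: S i j - (n%:R^-1)%:M.
  rewrite /line0 {1 2}wE outerDl !outerDr !outerZl !outerZr !scalerA wi wj /S.
  rewrite (mulrC (w j 0)) scalerDr; congr (_ - _).
  by rewrite -!addrA; congr (_ + _); rewrite [RHS]addrC -!addrA.
rewrite /S /line0.
move: (outer _ _) (outer _ _) (outer _ _) (outer _ _) _%:M => A B B' C K.
by apply/matrixP => k l; rewrite !mxE; field.
Qed.

Let tr_S M i j : M^T = M -> \tr (S i j *m M) = 2 * M i j.
Proof.
move=> Ms; rewrite /S mulmxDl linearD /= !outer_mulmx Ms !mxtrace_outer.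
rewrite !dot_evr -!colE !mxE; have -> : M j i = M i j by rewrite -{1}Ms mxE.
by rewrite mulr_natl mulr2n.
Qed.

Let S_symm0 i j : i != j -> symm0 (S i j).
Proof.
move=> ij; split; first by rewrite /S linearD /= !tr_outer addrC.
by rewrite /S linearD /= !mxtrace_outer !dot_ev eq_sym (negbTE ij) addr0.
Qed.

Lemma signed_diagonal : exists2 D : 'M[R]_n, orthogonalmx D &
  forall X, symm0 X -> T X = D *m X *m D^T.
Proof.
have T_off i j : i != j -> exists2 s, s ^+ 2 = 1 &
    forall X, symm0 X -> T X i j = s * X i j.
  move=> ij; have [s ss TSij] := T_S ij; exists s => // X Xs.
  have SE : S i j = s *: T (S i j) by rewrite TSij scalerA -expr2 ss scale1r.
  apply: (mulfI (_ : 2 != 0)); first by rewrite pnatr_eq0.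
  rewrite -tr_S; last exact: (Ts Xs).1.
  rewrite {1}SE -scalemxAl linearZ /= (Tiso (S_symm0 ij) Xs).
  rewrite tr_S; last exact: Xs.1.
  exact: mulrCA.
pose c : R := Num.sqrt n%:R^-1.
have cc : c * c = n%:R^-1 by rewrite -expr2 sqr_sqrtr// invr_ge0.
have c0 : c != 0 by apply/eqP => c0; move/eqP: cc; rewrite c0 mulr0 eq_sym invr_eq0 (negbTE n0).
(* The unit vector with equal entries detects all the signs at once. *)
pose v : 'cV[R]_n := const_mx c.
have v1 : dot v v = 1.
  rewrite /dot mxE; under eq_bigr do rewrite !mxE cc.
  by rewrite sumr_const card_ord -[_ *+ n]mulr_natr mulVf.
have [w w1 Tw] := Tv v1.
have ww i : w i 0 * w i 0 = n%:R^-1.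
  by rewrite -expr2 (T_line0_sqr i v1 Tw) mxE expr2 cc.
pose s : 'rV[R]_n := \row_i (c^-1 * w i 0).
have ss i : s 0 i * s 0 i = 1.
  by rewrite !mxE mulrACA ww -invfM cc invrK divff.
exists (diag_mx s).
  rewrite /orthogonalmx tr_diag_mx mulmx_diag; apply/matrixP => i j.
  by rewrite mxE [(\row_ _ _) 0 _]mxE ss mxE.
move=> X Xs; rewrite tr_diag_mx; apply/matrixP => i j.
rewrite mul_mx_diag mul_diag_mx !mxE -[c^-1 * _]/(_) .
have [->|ij] := eqVneq i j.
  by rewrite T_diag// mulrAC; have := ss j; rewrite !mxE => ->; rewrite mul1r.
have [t tt TXij] := T_off _ _ ij; rewrite TXij// mulrAC; congr (_ * _).
have := TXij _ (line0_symm0 n1 v1); rewrite Tw !line0_entry (negbTE ij) !mulr0n !subr0.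
rewrite !mxE cc => wij.
by rewrite mulrACA wij mulrCA -invfM cc invrK divff// mulr1.
Qed.
End SignedDiagonal.

Section Classification.
Variables (R : realType) (n : nat) (L : {linear 'M[R]_n -> 'M[R]_n}).
Hypothesis n1 : (1 < n)%N.
Hypothesis Ls : forall X, symm0 X -> symm0 (L X).
Hypothesis Liso : forall X Y, symm0 X -> symm0 Y -> \tr (L X *m L Y) = \tr (X *m Y).
Hypothesis Lonto : forall Y, symm0 Y -> exists2 X, symm0 X & L X = Y.
Hypothesis Lcomm : forall X Y, symm0 X -> symm0 Y ->
  X *m Y = Y *m X <-> L X *m L Y = L Y *m L X.

Let n0 : n%:R != 0 :> R.
Proof. by rewrite pnatr_eq0 -lt0n ltnW. Qed.

(** The images commute, so their lines are equal or orthogonal; with opposite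
    signs the squared cosine of their angle would be [2 / n], which lies strictly
    between 0 and 1. *)
Lemma line0_orthogonal_sign (u v a b : 'cV[R]_n) (e f : R) : (2 < n)%N ->
  dot u u = 1 -> dot v v = 1 -> dot a a = 1 -> dot b b = 1 -> dot u v = 0 ->
  e ^+ 2 = 1 -> f ^+ 2 = 1 ->
  L (line0 u) = e *: line0 a -> L (line0 v) = f *: line0 b -> e = f.
Proof.
move=> n2 u1 v1 a1 b1 uv ee ff Lu Lv.
have us := line0_symm0 n1 u1; have vs := line0_symm0 n1 v1.
have e0 : e != 0 by rewrite -sqrf_eq0 ee oner_eq0.
have f0 : f != 0 by rewrite -sqrf_eq0 ff oner_eq0.
set s := dot a b.
have tr : e * f * (s ^+ 2 - n%:R^-1) = - n%:R^-1.
  have := Liso us vs; rewrite Lu Lv -scalemxAl -scalemxAr scalerA linearZ /=.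
  by rewrite !dot_line0// uv expr0n sub0r.
have : L (line0 u) *m L (line0 v) = L (line0 v) *m L (line0 u).
  apply/(Lcomm us vs)/line0_comm.
  rewrite /line0 mulmxBl mulmxBr mul_scalar_mx mul_mx_scalar !outerM.
  by rewrite (dotC v u) uv !scale0r.
rewrite Lu Lv -!scalemxAl -!scalemxAr !scalerA (mulrC f).
move=> /(scalerI (mulf_neq0 e0 f0)) /line0_comm/esym/line0_comm.
rewrite !outerM (dotC b a) -/s => /(congr1 (mulmx^~ a)) /=.
rewrite -!scalemxAl !outer_mul a1 scale1r (dotC b a) -/s => E.
have s01 : s * (s ^+ 2 - 1) = 0.
  have := congr1 (dot b) E; rewrite !dotZr b1 (dotC b a) -/s => sE.
  by rewrite mulrBr expr2 -sE; ring.
have [->//|ef] := eqVneq e f.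
have eNf : e = - f.
  have /eqP := ee; rewrite -ff eqf_sqr => /orP[/eqP ef'|/eqP//].
  by rewrite ef' eqxx in ef.
move: tr; rewrite eNf mulNr -expr2 ff mulN1r => tr.
have nE : s ^+ 2 = 2 * n%:R^-1 by lra.
have nV0 : 0 < n%:R^-1 :> R by rewrite invr_gt0 ltr0n ltnW.
have nV : n%:R^-1 < 2^-1 :> R by rewrite ltf_pV2 ?posrE ?ltr_nat// ltr0n ltnW.
have /eqP := s01; rewrite nE mulf_eq0 => /orP[/eqP s0|/eqP s1].
  by move: nE; rewrite s0 expr0n /=; lra.
by exfalso; lra.
Qed.

(** When [n = 2] the projections on two orthogonal lines add up to the identity,
    so that the sign can be absorbed; when [n > 2] any two lines have a common
    orthogonal line. *)
Lemma image_line0_sign : exists2 e : R, e ^+ 2 = 1 &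
  forall v, dot v v = 1 -> exists2 w, dot w w = 1 & L (line0 v) = e *: line0 w.
Proof.
have [n2|n2] := ltnP 2 n; last first.
  exists 1; first by rewrite expr1n.
  move=> v v1; have [e [w [ee w1 Lv]]] := image_line0 n1 Ls Liso Lonto Lcomm v1.
  have /eqP := ee; rewrite sqrf_eq1 => /orP[/eqP e1|/eqP e1].
    by exists w; rewrite // -e1.
  (* Here [n = 2], and [line0 x = - line0 w] for [x] orthogonal to [w]. *)
  have [x x1 wx] := exists_orthogonal1 w n1.
  exists x => //; rewrite Lv e1 scale1r.
  pose P := 1%:M - (outer w w + outer x x).
  have nE : n = 2 by apply/eqP; rewrite eqn_leq n2.
  have P0 : P = 0.
    have Ps : P^T = P by rewrite /P linearB linearD /= trmx1 !tr_outer.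
    have PP : P *m P = P.
      rewrite {1}/P mulmxBl mul1mx mulmxDl /P !mulmxBr !mulmx1 !mulmxDr !outerM.
      rewrite w1 x1 wx (dotC x w) wx !scale0r !scale1r addr0 add0r !subrr.
      by rewrite addr0 subr0.
    apply: sqnorm_eq0; rewrite Ps PP /P linearB linearD /= mxtrace1 !mxtrace_outer.
    by rewrite w1 x1 nE subrr.
  have /eqP := P0; rewrite subr_eq0 /line0 scaleN1r opprB => /eqP owx.
  have -> : outer x x = 1%:M - outer w w by rewrite owx addrC addKr.
  rewrite addrAC; congr (_ - _); rewrite -raddfB; congr (_ %:M).
  by rewrite nE; field.
have [v0 v01 _] := exists_orthogonal1 (0 : 'cV[R]_n) n1.
have [e [w0 [ee w01 Lv0]]] := image_line0 n1 Ls Liso Lonto Lcomm v01.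
exists e => // v v1; have [f [w [ff w1 Lv]]] := image_line0 n1 Ls Liso Lonto Lcomm v1.
have [x x1 [vx v0x]] := exists_orthogonal2 v v0 n2.
have [g [y [gg y1 Lx]]] := image_line0 n1 Ls Liso Lonto Lcomm x1.
exists w => //; rewrite (line0_orthogonal_sign n2 v01 x1 w01 y1 v0x ee gg Lv0 Lx).
by rewrite -(line0_orthogonal_sign n2 v1 x1 w1 y1 vx ff gg Lv Lx).
Qed.

(** Once the common sign is removed and the images of the coordinate lines are
    brought back by an orthogonal conjugation, [signed_diagonal] applies. *)
Theorem commutation_isometry : exists (e : R) (O : 'M[R]_n),
  [/\ e ^+ 2 = 1, orthogonalmx O &
      forall X, symm0 X -> L X = e *: (O *m X *m O^T)].
Proof.
have [e ee Le] := image_line0_sign.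
pose ev i : 'cV[R]_n := delta_mx i 0.
have dev i j : dot (ev i) (ev j) = (i == j)%:R.
  by rewrite /dot /ev -colE !mxE eqxx andbT eq_sym.
have /choice[F FP] : forall i, exists w, dot w w = 1 /\ L (line0 (ev i)) = e *: line0 w.
  by move=> i; have [|w w1 Lw] := Le (ev i); [rewrite dev eqxx|exists w].
pose P : 'M[R]_n := \matrix_(i, j) F j i 0.
have Pev i : P *m ev i = F i by rewrite /ev -colE; apply/colP => k; rewrite !mxE.
have oP : orthogonalmx P.
  apply/matrixP => i j; rewrite mxE.
  have -> : \sum_k P^T i k * P k j = dot (F i) (F j).
    by rewrite /dot mxE; apply: eq_bigr => k _; rewrite !mxE.
  rewrite mxE; have [<-|ij] := eqVneq i j; first exact: (FP i).1.
  have di k : dot (ev k) (ev k) = 1 by rewrite dev eqxx.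
  have := Liso (line0_symm0 n1 (di i)) (line0_symm0 n1 (di j)).
  rewrite (FP i).2 (FP j).2 -scalemxAl -scalemxAr scalerA -expr2 ee scale1r.
  rewrite !dot_line0 ?di ?(FP _).1// dev (negbTE ij) => /addIr/eqP.
  by rewrite expr0n /= sqrf_eq0 => /eqP.
have PP := orthogonalmx_tr oP.
pose T X := e *: (P^T *m L X *m P).
have LT X : L X = e *: (P *m T X *m P^T).
  rewrite /T -scalemxAr -scalemxAl scalerA -expr2 ee scale1r.
  by rewrite !mulmxA PP mul1mx -mulmxA PP mulmx1.
have Ts X : symm0 X -> symm0 (T X).
  move=> /Ls[LXs LXt]; split; first by rewrite /T linearZ /= !trmx_mul trmxK LXs mulmxA.
  by rewrite /T linearZ /= mxtrace_mulC mulmxA PP mul1mx LXt mulr0.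
have Pline v : P^T *m line0 v *m P = line0 (P^T *m v).
  rewrite /line0 mulmxBr mulmxBl mul_mx_scalar -scalemxAl oP scalemx1.
  by rewrite mulmx_outer outer_mulmx.
have Tline v w : L (line0 v) = e *: line0 w -> T (line0 v) = line0 (P^T *m w).
  by move=> Lv; rewrite /T Lv -scalemxAr -scalemxAl scalerA -expr2 ee scale1r Pline.
have [||||||D oD TD] := @signed_diagonal R n T n1.
- by move=> X Y; rewrite /T linearD mulmxDr mulmxDl scalerDr.
- by move=> a X; rewrite /T linearZ /= -scalemxAr -scalemxAl !scalerA mulrC.
- exact: Ts.
- move=> X Y Xs Ys; rewrite -(Liso Xs Ys) /T -!scalemxAl -!scalemxAr scalerA.
  rewrite -expr2 ee scale1r !mulmxA -(mulmxA _ P P^T) PP mulmx1.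
  by rewrite mxtrace_mulC !mulmxA PP mul1mx.
- by move=> i; rewrite -/(ev i) (Tline _ _ (FP i).2) -Pev mulmxA oP mul1mx.
- move=> v v1; have [w w1 Lv] := Le v v1; exists (P^T *m w); last exact: Tline.
  by rewrite dot_mulmx trmxK mulmxA PP mul1mx.
exists e, (P *m D); split=> //.
  by rewrite /orthogonalmx trmx_mul !mulmxA -(mulmxA _ P^T) oP mulmx1 oD.
by move=> X Xs; rewrite LT TD// trmx_mul !mulmxA.
Qed.
End Classification.

(** * Differentiation along curves and symmetry of second derivatives *)

Section Curves.
Variable R : realType.

Lemma is_derive_comp_curve (V W : normedModType R) (F : V -> W) (c : R -> V)
    (t : R) (v : V) :
  differentiable F (c t) -> is_derive t 1 c v ->
  is_derive t 1 (F \o c) ('d F (c t) v).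
Proof.
move=> dF [dc cv]; have dct : differentiable c t by apply/derivable1_diffP.
split; first by apply/derivable1_diffP; exact: differentiable_comp.
by rewrite deriveE; [rewrite diff_comp//= -cv deriveE|exact: differentiable_comp].
Qed.

Lemma is_derive_line (V : normedModType R) (p v : V) (t : R) :
  is_derive t 1 (fun s : R => p + s *: v) v.
Proof.
have : is_derive t 1 (cst p + (fun s : R => s *: v)) (0 + v).
  apply: is_deriveD; have [dv dvE] := is_diff_scalel t v.
  split; first exact/derivable1_diffP.
  by rewrite deriveE// dvE scale1r.
by rewrite add0r.
Qed.

Lemma is_derive_along (V W : normedModType R) (F : V -> W) (p v : V) (t : R) :
  differentiable F (p + t *: v) ->
  is_derive t 1 (fun s : R => F (p + s *: v)) ('D_v F (p + t *: v)).
Proof.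
move=> dF; rewrite deriveE//.
exact: (is_derive_comp_curve (c := fun s : R => p + s *: v) dF (is_derive_line p v t)).
Qed.

Lemma mean_value_along (V : normedModType R) (f : V -> R) (p v : V) (h : R) :
  0 < h -> (forall s, 0 <= s <= h -> differentiable f (p + s *: v)) ->
  exists2 s, 0 < s < h & f (p + h *: v) - f p = h * 'D_v f (p + s *: v).
Proof.
move=> h0 df; pose g s := f (p + s *: v).
have dg s : 0 <= s <= h -> is_derive s 1 g ('D_v f (p + s *: v)).
  by move=> hs; apply: is_derive_along; exact: df.
have [||s] := @MVT R g (fun s => 'D_v f (p + s *: v)) 0 h h0.
- by move=> s; rewrite in_itv/= => /andP[s0 sh]; apply: dg; rewrite !ltW.
- apply: derivable_within_continuous => s; rewrite in_itv/= => hs.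
  by have [] := dg s hs.
rewrite in_itv/= => hs; rewrite /g scale0r addr0 subr0 => E.
by exists s => //; rewrite E mulrC.
Qed.

(** Two applications of the mean value theorem express the second difference
    as a mixed second derivative at an intermediate point. *)
Lemma second_difference (V : normedModType R) (f fv : V -> R) (p v w : V)
    (U : set V) (h : R) :
  (forall x, U x -> differentiable f x) -> (forall x, U x -> 'D_v f x = fv x) ->
  (forall x, U x -> differentiable fv x) ->
  0 < h -> (forall s t, 0 <= s <= h -> 0 <= t <= h -> U (p + s *: v + t *: w)) ->
  exists s t, [/\ 0 <= s <= h, 0 <= t <= h &
    f (p + h *: v + h *: w) - f (p + h *: v) - (f (p + h *: w) - f p)
    = h * h * 'D_w fv (p + s *: v + t *: w)].
Proof.
move=> df fvE dvf h0 hU; have h00 : 0 <= (0 : R) <= h by rewrite lexx ltW.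
have hhh : 0 <= h <= h by rewrite lexx ltW.
pose g x := f (x + h *: w) - f x.
have dsh x : U (x + h *: w) -> differentiable (fun y => f (y + h *: w)) x.
  move=> Ux; apply: (@differentiable_comp _ _ _ _ (fun y => y + h *: w) f); last exact: df.
  by apply: differentiableD; [exact: ex_diff|exact: differentiable_cst].
have [|s /andP[s0 sh] gE] := @mean_value_along V g p v h h0.
  move=> s hs; apply: differentiableB; first by apply: dsh; exact: hU.
  by apply: df; have := hU s 0 hs h00; rewrite scale0r addr0.
have hs : 0 <= s <= h by rewrite !ltW.
have [|t /andP[t0 th] dE] := @mean_value_along V fv (p + s *: v) w h h0.
  by move=> t ht; apply: dvf; exact: hU.
exists s, t; split=> //; first by rewrite !ltW.
rewrite -mulrA -dE.
have -> : f (p + h *: v + h *: w) - f (p + h *: v) - (f (p + h *: w) - f p) =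
  g (p + h *: v) - g p by [].
rewrite gE; congr (_ * _).
have Up : U (p + s *: v + h *: w) by apply: hU.
have Up0 : U (p + s *: v) by have := hU s 0 hs h00; rewrite scale0r addr0.
rewrite -!fvE// /g deriveB; [|exact/diff_derivable/dsh|exact/diff_derivable/df].
suff -> : 'D_v (fun y => f (y + h *: w)) (p + s *: v) = 'D_v f (p + s *: v + h *: w) by [].
rewrite /derive; set F1 := fun _ : R => _; set F2 := fun _ : R => _.
by have -> : F1 = F2 by apply/funext => k; rewrite /F1 /F2 /= -!addrA.
Qed.

(** Symmetry of second derivatives. The derivatives are named by functions that
    agree with them on [U] only, so that the lemma applies entrywise to
    matrix-valued maps. *)
Lemma mixed_derivatives_commute (V : normedModType R) (f fv fw fvw fwv : V -> R)
    (x v w : V) (U : set V) : open U -> U x ->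
  (forall y, U y -> differentiable f y) ->
  (forall y, U y -> differentiable fv y) -> (forall y, U y -> differentiable fw y) ->
  (forall y, U y -> 'D_v f y = fv y) -> (forall y, U y -> 'D_w f y = fw y) ->
  (forall y, U y -> 'D_w fv y = fvw y) -> (forall y, U y -> 'D_v fw y = fwv y) ->
  {for x, continuous fvw} -> {for x, continuous fwv} -> fvw x = fwv x.
Proof.
move=> oU Ux df dfv dfw fvE fwE fvwE fwvE cvw cwv.
apply/eqP; rewrite -subr_eq0 -normr_le0; apply/ler_addgt0Pl => e e0; rewrite addr0.
have close (a b c : R) : `|a - c| < e / 2 -> `|b - c| < e / 2 -> `|a - b| <= e.
  move=> ac bc; rewrite [e]splitr -(subrKA c) (le_trans (ler_normD _ _))// lerD ?ltW//.
  by rewrite distrC.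
have e20 : 0 < e / 2 by rewrite divr_gt0.
have /cvgrPdist_lt/(_ _ e20) n1 := cvw.
have /cvgrPdist_lt/(_ _ e20) n2 := cwv.
have nU : \forall y \near x, U y by exact: open_nbhs_nbhs.
have /nbhs_ballP[r /= r0 rP] : \forall y \near x, [/\ U y,
    `|fvw x - fvw y| < e / 2 & `|fwv x - fwv y| < e / 2].
  apply: (@filterS3 _ (nbhs x) _ _ _ _ _ _ nU n1 n2) => y uy e1 e2.
  exact: And3 uy e1 e2.
pose N := `|v| + `|w| + 1.
have N0 : 0 < N by rewrite ltr_wpDl// addr_ge0.
pose h := r / N / 2.
have h0 : 0 < h by rewrite !divr_gt0.
have same_second (a b c d D1 D2 : R) :
    a - b - (c - d) = h * h * D1 -> a - c - (b - d) = h * h * D2 -> D1 = D2.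
  move=> E1 E2; apply: (mulfI (_ : h * h != 0)); first by rewrite mulf_neq0 ?gt_eqF.
  by rewrite -E1 -E2; ring.
have hb s t a b : `|a| + `|b| < N -> 0 <= s <= h -> 0 <= t <= h ->
    ball x r (x + s *: a + t *: b).
  move=> aN /andP[s0 sh] /andP[t0 th]; rewrite -ball_normE /ball_/=.
  rewrite -addrA opprD addrA subrr sub0r normrN.
  rewrite (le_lt_trans (ler_normD _ _))// !normrZ !ger0_norm//.
  rewrite (@le_lt_trans _ _ (h * (`|a| + `|b|)))//.
    by rewrite mulrDr lerD// ler_wpM2r.
  rewrite (@lt_trans _ _ (h * N))// ?ltr_pM2l//.
  by rewrite /h mulrAC divfK ?gt_eqF// gtr_pMr// invf_lt1// ltr1n.
have vwN : `|v| + `|w| < N by rewrite ltrDl.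
have wvN : `|w| + `|v| < N by rewrite addrC.
have [|s [t [hs ht E1]]] := @second_difference V f fv x v w U h df fvE dfv h0.
  by move=> s t hs ht; have [] := rP _ (hb s t v w vwN hs ht).
have [|s' [t' [hs' ht' E2]]] := @second_difference V f fw x w v U h df fwE dfw h0.
  by move=> s' t' hs' ht'; have [] := rP _ (hb s' t' w v wvN hs' ht').
have [u1 b1 _] := rP _ (hb s t v w vwN hs ht).
have [u2 _ b2] := rP _ (hb s' t' w v wvN hs' ht').
rewrite (addrAC x (h *: w) (h *: v)) in E2.
rewrite fvwE// in E1; rewrite fwvE// in E2.
rewrite -(same_second _ _ _ _ _ _ E1 E2) in b2; exact: close b1 b2.
Qed.

Lemma differentiable_entry (V : normedModType R) m n (F : V -> 'M[R]_(m, n)) x i j :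
  differentiable F x -> differentiable (fun y => F y i j) x.
Proof.
move=> dF; apply: (@differentiable_comp _ _ _ _ F (fun M : 'M[R]_(m, n) => M i j)) => //.
exact: differentiable_coord.
Qed.

Lemma derive_entry (V : normedModType R) m n (F : V -> 'M[R]_(m, n)) x v i j :
  differentiable F x -> 'D_v (fun y => F y i j) x = 'D_v F x i j.
Proof. by move=> dF; rewrite derive_mx ?mxE//; exact: diff_derivable. Qed.

Lemma continuous_entry (V : normedModType R) m n (F : V -> 'M[R]_(m, n)) x i j :
  {for x, continuous F} -> {for x, continuous (fun y => F y i j)}.
Proof.
move=> cF; apply: (@continuous_comp _ _ _ F (fun M : 'M[R]_(m, n) => M i j)) => //.
exact: coord_continuous.
Qed.

Lemma mixed_derivatives_commute_mx (V : normedModType R) m n (F : V -> 'M[R]_(m, n))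
    (x v w : V) (U : set V) :
  open U -> U x -> Ck_on 2 U F -> 'D_w ('D_v F) x = 'D_v ('D_w F) x.
Proof.
move=> oU Ux [dF dF2]; have [dv cv] := dF2 v; have [dw cw] := dF2 w.
apply/matrixP => i j.
apply: (@mixed_derivatives_commute V (fun y => F y i j) (fun y => 'D_v F y i j)
  (fun y => 'D_w F y i j) (fun y => 'D_w ('D_v F) y i j)
  (fun y => 'D_v ('D_w F) y i j) x v w U oU Ux).
- by move=> y /dF; exact: differentiable_entry.
- by move=> y /dv; exact: differentiable_entry.
- by move=> y /dw; exact: differentiable_entry.
- by move=> y Uy; rewrite derive_entry//; exact: dF.
- by move=> y Uy; rewrite derive_entry//; exact: dF.
- by move=> y Uy; rewrite derive_entry//; exact: dv.
- by move=> y Uy; rewrite derive_entry//; exact: dw.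
- by apply: continuous_entry; exact: cv.
- by apply: continuous_entry; exact: cw.
Qed.

End Curves.

(** * Smoothness of polynomial maps and of exponential curves *)

Section Smooth.
Variables (R : realType) (V : normedModType R).

Lemma Ck_sub (W : normedModType R) k (U U' : set V) (f : V -> W) :
  U `<=` U' -> Ck_on k U' f -> Ck_on k U f.
Proof.
move=> UU'; elim: k f => [|k IH] f /=; first by move=> cf x /UU'; exact: cf.
by move=> [df Df]; split=> [x /UU'|v]; [exact: df|exact: IH].
Qed.

Lemma CkS (W : normedModType R) k (U : set V) (f : V -> W) :
  Ck_on k.+1 U f -> Ck_on k U f.
Proof.
elim: k f => [|k IH] f [df Df]; first by move=> x /df; exact: differentiable_continuous.
by split=> // v; apply: IH; exact: Df.
Qed.

Lemma Ck_cst (W : normedModType R) k (w : W) : Ck_on k setT (cst w : V -> W).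
Proof.
elim: k w => [|k IH] w /=; first by move=> x _; exact: cvg_cst.
split=> [x _|v]; first exact: differentiable_cst.
by have -> : 'D_v (cst w) = cst 0 by apply/funext => x; rewrite derive_cst.
Qed.

Lemma Ck_linear (W : normedModType R) k (f : {linear V -> W}) :
  continuous f -> Ck_on k setT f.
Proof.
move=> cf; case: k => [|k] /=; first by move=> x _; exact: cf.
split=> [x _|v]; first exact: linear_differentiable.
have -> : 'D_v f = cst (f v).
  by apply/funext => x; rewrite deriveE ?diff_lin//; exact: linear_differentiable.
exact: Ck_cst.
Qed.


Lemma CkD (W : normedModType R) k (f g : V -> W) :
  Ck_on k setT f -> Ck_on k setT g -> Ck_on k setT (f + g).
Proof.
elim: k f g => [|k IH] f g /=; first by move=> cf cg x _; apply: cvgD; [exact: cf|exact: cg].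
move=> [df Df] [dg Dg]; split=> [x _|v].
  by apply: differentiableD; [exact: df|exact: dg].
have -> : 'D_v (f + g) = 'D_v f + 'D_v g; last exact: (IH _ _ (Df v) (Dg v)).
apply/funext => x; have dfx := diff_derivable (v := v) (df x I).
have dgx := diff_derivable (v := v) (dg x I).
exact: (deriveD dfx dgx).
Qed.

Lemma CkM k (f g : V -> R) :
  Ck_on k setT f -> Ck_on k setT g -> Ck_on k setT (f * g).
Proof.
elim: k f g => [|k IH] f g; first by move=> cf cg x _; apply: cvgM; [exact: cf|exact: cg].
move=> Cf Cg; have Cf' := CkS Cf; have Cg' := CkS Cg.
case: Cf => df Df; case: Cg => dg Dg; split=> [x _|v].
  by apply: differentiableM; [exact: df|exact: dg].
have -> : 'D_v (f * g) = f * 'D_v g + g * 'D_v f.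
  apply/funext => x; have dfx := diff_derivable (v := v) (df x I).
  have dgx := diff_derivable (v := v) (dg x I).
  exact: (deriveM dfx dgx).
by apply: CkD; [exact: (IH _ _ Cf' (Dg v))|exact: (IH _ _ Cg' (Df v))].
Qed.

Lemma CkZl (W : normedModType R) k (f : V -> R) (w : W) :
  Ck_on k setT f -> Ck_on k setT (fun x => f x *: w).
Proof.
elim: k f => [|k IH] f; first by move=> cf x _; apply: cvgZl; exact: cf.
case=> df Df; split=> [x _|v]; first by apply: differentiableZl; exact: df.
have -> : 'D_v (fun x => f x *: w) = (fun x => 'D_v f x *: w); last exact: (IH _ (Df v)).
apply/funext => x; have dfx := df x I.
by rewrite (deriveE v (differentiableZl w dfx)) (deriveE v dfx) diffZl.
Qed.

Lemma Ck_sum (W : normedModType R) k (I : Type) (r : seq I) (P : pred I) (f : I -> V -> W) :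
  (forall i, Ck_on k setT (f i)) -> Ck_on k setT (\sum_(i <- r | P i) f i).
Proof.
move=> Cf; elim/big_ind: _ => //; last by move=> *; exact: CkD.
exact: (Ck_cst k 0).
Qed.

Lemma Ck_prod k (I : Type) (r : seq I) (P : pred I) (f : I -> V -> R) :
  (forall i, Ck_on k setT (f i)) -> Ck_on k setT (\prod_(i <- r | P i) f i).
Proof.
move=> Cf; elim/big_ind: _ => //; last by move=> *; exact: CkM.
exact: (Ck_cst k (1 : R)).
Qed.

Lemma Ck_mx k m n (F : V -> 'M[R]_(m, n)) :
  (forall i j, Ck_on k setT (fun x => F x i j)) -> Ck_on k setT F.
Proof.
move=> CF.
have -> : F = \sum_i \sum_j (fun x => F x i j *: delta_mx i j).
  apply/funext => x; rewrite fct_sumE [LHS]matrix_sum_delta.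
  by apply: eq_bigr => i _; rewrite fct_sumE.
by apply: Ck_sum => i; apply: Ck_sum => j; exact: CkZl.
Qed.

Lemma Ck_det k n (F : V -> 'M[R]_n) :
  (forall i j, Ck_on k setT (fun x => F x i j)) -> Ck_on k setT (fun x => \det (F x)).
Proof.
move=> CF.
have -> : (fun x => \det (F x)) =
    \sum_(s : {perm 'I_n}) (cst ((-1) ^+ s) * \prod_i (fun x => F x i (s i))).
  apply/funext => x; rewrite fct_sumE; apply: eq_bigr => s _.
  by rewrite /= [RHS]/(_ * _) fct_prodE.
by apply: Ck_sum => s; apply: CkM; [exact: Ck_cst|exact: Ck_prod].
Qed.
End Smooth.

Section MatrixMaps.
Variables (R : realType) (n : nat).

Lemma Ck_entry k i j : Ck_on k setT (fun A : 'M[R]_n => A i j).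
Proof.
pose f (A : 'M[R]_n) := A i j.
have lf : linear f by move=> a A B; rewrite /f !mxE.
pose fL := GRing.isLinear.Build _ _ _ _ _ lf.
pose F : {linear 'M[R]_n -> R} := HB.pack f fL.
by apply: (@Ck_linear R _ _ k F); exact: coord_continuous.
Qed.

(** Entries of the adjugate are signed minors, hence polynomials. On matrices of
    determinant 1 the adjugate is the inverse, and unlike it extends to a smooth
    map on the whole space. *)
Lemma Ck_adjugate_entry k i j : Ck_on k setT (fun A : 'M[R]_n => (\adj A) i j).
Proof.
have -> : (fun A : 'M[R]_n => (\adj A) i j) =
  cst ((-1) ^+ (j + i)) * (fun A => \det (row' j (col' i A))).
  by apply/funext => A; rewrite mxE.
apply: CkM; first exact: Ck_cst.
apply: (Ck_det (F := fun A : 'M[R]_n => row' j (col' i A))) => a b.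
have -> : (fun A : 'M[R]_n => row' j (col' i A) a b) = (fun A => A (lift j a) (lift i b)).
  by apply/funext => A; rewrite !mxE.
exact: Ck_entry.
Qed.

Lemma Ck_adjugate k : Ck_on k setT (fun A : 'M[R]_n => \adj A).
Proof. by apply: Ck_mx => i j; exact: Ck_adjugate_entry. Qed.

Lemma Ck_congruence (V : normedModType R) k (P Q : 'M[R]_n) (F : V -> 'M[R]_n) :
  (forall i j, Ck_on k setT (fun x => F x i j)) ->
  Ck_on k setT (fun x => P *m F x *m Q).
Proof.
move=> CF; apply: Ck_mx => i j.
have -> : (fun x => (P *m F x *m Q) i j) =
    \sum_b \sum_a (cst (P i a * Q b j) * (fun x => F x a b)).
  apply/funext => x; rewrite fct_sumE mxE; apply: eq_bigr => b _.
  rewrite fct_sumE mxE mulr_suml; apply: eq_bigr => a _.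
  by rewrite mulrAC.
by apply: Ck_sum => b; apply: Ck_sum => a; apply: CkM; [exact: Ck_cst|exact: CF].
Qed.

End MatrixMaps.

Section ExponentialCurves.
Variables (R : realType) (n : nat).
Implicit Types X P Q : 'M[R]_n.

Lemma is_derive_expmx X (t : R) : X^T = X ->
  is_derive t 1 (fun s : R => expmx (s *: X)) (expmx (t *: X) *m X).
Proof.
move=> Xs; have [ O [d [oO ->]]] := real_spectral Xs.
rewrite (_ : (fun s : R => _) =
    fun s => O^T *m diag_mx (map_mx (fun x => expR (s * x)) d) *m O); last first.
  by apply/funext => s; rewrite expmx_scaleE.
have dD : is_derive t 1 (fun s => diag_mx (map_mx (fun x => expR (s * x)) d))
    (diag_mx (\row_i (d 0 i * expR (t * d 0 i)))).
  apply/is_derive_mxP => i j; rewrite !mxE.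
  have [<-|ij] := eqVneq i j; last first.
    rewrite mulr0n (_ : (fun _ => _) = cst 0); first exact: is_derive_cst.
    by apply/funext => s; rewrite !mxE (negbTE ij).
  rewrite mulr1n (_ : (fun _ => _) = expR \o (fun s : R => s * d 0 i)); last first.
    by apply/funext => s; rewrite !mxE eqxx mulr1n.
  rewrite mulrC; apply: is_derive1_comp.
  have := is_deriveM (is_derive_id t 1) (is_derive_cst (d 0 i) t 1).
  by rewrite scaler0 add0r [_ *: 1]mulr1.
have := is_derive_mulmx (is_derive_mulmx (is_derive_cst O^T t 1) dD) (is_derive_cst O t 1).
rewrite mulmx0 addr0 mul0mx add0r => /is_derive_eq; apply.
rewrite expmx_scaleE// !mulmxA -(mulmxA _ O) orthogonalmx_tr// mulmx1.
rewrite -[in RHS](mulmxA O^T) mulmx_diag; congr (_ *m diag_mx _ *m _).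
by apply/rowP => i; rewrite !mxE mulrC.
Qed.

Lemma is_derive_mulmx_cst (V : normedModType R) (c : V -> 'M[R]_n) P Q t v dc :
  is_derive t v c dc -> is_derive t v (fun s => P *m c s *m Q) (P *m dc *m Q).
Proof.
move=> dc'.
have := is_derive_mulmx (is_derive_mulmx (is_derive_cst P t v) dc') (is_derive_cst Q t v).
by rewrite mulmx0 addr0 mul0mx add0r.
Qed.

Lemma is_derive_exp_curve X P Q (t : R) : X^T = X ->
  is_derive t 1 (fun s : R => P *m expmx (s *: X) *m Q)
    (P *m (expmx (t *: X) *m X) *m Q).
Proof. by move=> Xs; apply: is_derive_mulmx_cst; exact: is_derive_expmx. Qed.

(** Differentiating [P e^(sX) Q] replaces [Q] by a multiple of [X Q], so the class
    of these curves is stable and induction on the order applies. *)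
Lemma smooth_exp_curve X P Q (U : set R^o) : X^T = X ->
  smooth_on U (fun s : R^o => P *m expmx (s *: X) *m Q).
Proof.
move=> Xs k; apply: (@Ck_sub R _ _ k U setT) => //.
elim: k P Q => [|k IH] P Q /=.
  move=> t _; apply: (@differentiable_continuous R R^o _ t).
  by apply/derivable1_diffP; case: (is_derive_exp_curve P Q t Xs).
split=> [t _|v]; first by apply/derivable1_diffP; case: (is_derive_exp_curve P Q t Xs).
have -> : 'D_v (fun s : R^o => P *m expmx (s *: X) *m Q) =
    (fun s => P *m expmx (s *: X) *m (v *: (X *m Q))); last exact: IH.
apply/funext => t; have [dt Et] := is_derive_exp_curve P Q t Xs.
have dft : differentiable (fun s : R^o => P *m expmx (s *: X) *m Q) (t : R^o).
  exact/derivable1_diffP.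
have vE : v = v *: (1 : R^o) by rewrite [RHS]mulr1.
by rewrite deriveE// [in LHS]vE linearZ /= -deriveE// Et -[in RHS]scalemxAr !mulmxA.
Qed.

End ExponentialCurves.

(** * The manifold and its tangent vectors *)

Section Manifold.
Variables (R : realType) (n : nat).
Implicit Types A B M P Q V X Y Z : 'M[R]_n.

Lemma mulmx1_invmx A B : A *m B = 1%:M -> invmx A = B.
Proof.
move=> AB; have [Au _] := mulmx1_unit AB.
by rewrite -[RHS]mul1mx -(mulVmx Au) -mulmxA AB mulmx1.
Qed.

Lemma invmx_mulmx A B : A \in unitmx -> B \in unitmx ->
  invmx (A *m B) = invmx B *m invmx A.
Proof.
move=> Au Bu; apply: mulmx1_invmx.
by rewrite mulmxA -(mulmxA A) mulmxV// mulmx1 mulmxV.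
Qed.

Lemma mulmx_conjK V M : V \in unitmx -> V *m (invmx V *m M *m invmx V) *m V = M.
Proof. by move=> Vu; rewrite !mulmxA mulmxV// mul1mx mulmxKV. Qed.

Lemma mulmx_conjVK V M : V \in unitmx -> invmx V *m (V *m M *m V) *m invmx V = M.
Proof. by move=> Vu; rewrite !mulmxA mulVmx// mul1mx mulmxK. Qed.

Lemma trace_metric_congruence P A X Y : P \in unitmx -> A \in unitmx ->
  trace_metric (P *m A *m P^T) (P *m X *m P^T) (P *m Y *m P^T) = trace_metric A X Y.
Proof.
move=> Pu Au; have Ptu : P^T \in unitmx by rewrite unitmx_tr.
have iE : invmx (P *m A *m P^T) = invmx P^T *m invmx A *m invmx P.
  by rewrite !invmx_mulmx ?unitmx_mul ?Pu// mulmxA.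
have k N : invmx (P *m A *m P^T) *m (P *m N *m P^T) =
    invmx P^T *m (invmx A *m N) *m P^T.
  by rewrite iE !mulmxA -(mulmxA _ (invmx P) P) mulVmx// mulmx1.
rewrite /trace_metric k -mulmxA k !mulmxA -(mulmxA _ P^T (invmx P^T)) mulmxV//.
by rewrite mulmx1 mxtrace_mulC !mulmxA mulmxV// mul1mx.
Qed.

Lemma trace_metric1 X Y : trace_metric 1%:M X Y = \tr (X *m Y).
Proof. by rewrite /trace_metric invmx1 mul1mx mulmx1. Qed.

Lemma trace_metric_frame P X Y : P \in unitmx ->
  trace_metric (P *m P^T) (P *m X *m P^T) (P *m Y *m P^T) = \tr (X *m Y).
Proof.
move=> Pu; have := trace_metric_congruence X Y Pu (unitmx1 R n).
by rewrite mulmx1 trace_metric1.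
Qed.

Lemma expmx_unit X : X^T = X -> expmx X \in unitmx.
Proof. by move=> Xs; have /mulmx1_unit[] := expmxN Xs. Qed.

Lemma expmx_inv X : X^T = X -> invmx (expmx X) = expmx (- X).
Proof. by move=> Xs; apply: mulmx1_invmx; apply: mulmx1C; exact: expmxN. Qed.

Lemma SLP_unit A : SLP R n A -> A \in unitmx.
Proof. by case=> _ dA; rewrite unitmxE dA unitr1. Qed.

Lemma SLP_sym A : SLP R n A -> A^T = A.
Proof. by case=> -[]. Qed.

Lemma det_pm1_sqr X : \det X = 1 \/ \det X = -1 <-> \det X * \det X = 1.
Proof.
split=> [[->|->]|]; rewrite ?mulr1 ?mulrNN ?mulr1//.
by move=> /eqP; rewrite -expr2 sqrf_eq1 => /orP[/eqP|/eqP]; [left|right].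
Qed.

Lemma det_pm1_unit X : \det X * \det X = 1 -> X \in unitmx.
Proof.
move=> dX; rewrite unitmxE unitfE; apply/eqP => d0; move/eqP: dX.
by rewrite d0 mulr0 eq_sym oner_eq0.
Qed.

Lemma SLP_congruence A P : \det P * \det P = 1 -> SLP R n A -> SLP R n (P *m A *m P^T).
Proof.
move=> dP [[As Ap] dA]; split; last by rewrite !det_mulmx dA mulr1 det_tr.
split; first by rewrite !trmx_mul trmxK As mulmxA.
move=> x x0; rewrite !mulmxA -[x^T *m P]trmxK trmx_mul trmxK.
rewrite -[_ *m P^T *m x]mulmxA; apply: Ap; apply: contra x0 => /eqP Px.
have Pu : P^T \in unitmx by rewrite unitmx_tr; exact: det_pm1_unit.
by rewrite -[x]mul1mx -(mulVmx Pu) -mulmxA Px mulmx0.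
Qed.

Lemma SLP_inv A : SLP R n A -> SLP R n (invmx A).
Proof.
move=> SA; have Au := SLP_unit SA.
have -> : invmx A = invmx A *m A *m (invmx A)^T.
  by rewrite mulVmx// mul1mx trmx_inv (SLP_sym SA).
by apply: SLP_congruence => //; rewrite det_inv SA.2 invr1 mulr1.
Qed.

Lemma SLP_sqrt A : SLP R n A -> exists2 V, SLP R n V & A = V *m V.
Proof.
move=> /SLP_expmx[X [Xs Xt] ->]; exists (expmx (2^-1 *: X)).
  by apply: expmx_SLP; split; rewrite linearZ /= ?Xs// Xt mulr0.
by rewrite -expmxD// -div1r -splitr scale1r.
Qed.

(** From [1 + x <= e^x] applied to the eigenvalues of the logarithm. *)
Lemma SLP_trace_ge A : SLP R n A -> n%:R <= \tr A.
Proof.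
move=> /SLP_expmx[X [Xs Xt] ->]; have [ O [d [oO XE]]] := real_spectral Xs.
have := expmx_scaleE d 1 oO; rewrite -XE scale1r => ->.
rewrite tr_orth_conj//; under eq_bigr do rewrite mxE mul1r.
have : \sum_(i < n) (1 + d 0 i) <= \sum_(i < n) expR (d 0 i).
  by apply: ler_sum => i _; exact: expR_ge1Dx.
by rewrite big_split /= -(tr_orth_conj d oO) -XE Xt addr0 sumr_const card_ord.
Qed.

Lemma symm0_scale (a : R) X : symm0 X -> symm0 (a *: X).
Proof. by move=> [Xs Xt]; split; rewrite linearZ /= ?Xs// Xt mulr0. Qed.

Lemma is_derive_mxtrace (V : normedModType R) (c : V -> 'M[R]_n) t v dc :
  is_derive t v c dc -> is_derive t v (fun s => \tr (c s)) (\tr dc).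
Proof.
move=> /is_derive_mxP dcP.
rewrite (_ : (fun s => _) = \sum_i (fun s => c s i i)).
  by apply: is_derive_sum.
by apply/funext => s; rewrite fct_sumE.
Qed.

Lemma is_derive_trmx (V : normedModType R) (c : V -> 'M[R]_n) t v dc :
  is_derive t v c dc -> is_derive t v (fun s => (c s)^T) dc^T.
Proof.
move=> /is_derive_mxP dcP; apply/is_derive_mxP => i j.
rewrite mxE (_ : (fun s => _) = (fun s => c s j i)) //.
by apply/funext => s; rewrite mxE.
Qed.

Lemma is_derive_unique (V W : normedModType R) (f : V -> W) t v a b :
  is_derive t v f a -> is_derive t v f b -> a = b.
Proof. by move=> [_ <-] [_ <-]. Qed.

(** Since the trace is at least [n] on the manifold, with equality at the
    identity, its derivative vanishes there; congruence moves any other point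
    to the identity. *)
Lemma SLP_velocity (c : R -> 'M[R]_n) (t : R) dc :
  (forall s, SLP R n (c s)) -> (forall s, derivable c s 1) ->
  is_derive t 1 c dc -> dc^T = dc /\ \tr (invmx (c t) *m dc) = 0.
Proof.
move=> cS cd dct; split.
  apply: (is_derive_unique (is_derive_trmx dct)).
  by rewrite (_ : (fun s => (c s)^T) = c)//; apply/funext => s; exact: SLP_sym.
have [V VS cE] := SLP_sqrt (cS t); have Vu := SLP_unit VS.
pose b s := \tr (invmx V *m c s *m invmx V).
have db (s : R) ds : is_derive s 1 c ds -> is_derive s 1 b (\tr (invmx V *m ds *m invmx V)).
  by move=> dcs; apply: is_derive_mxtrace; exact: is_derive_mulmx_cst.
have bmin : is_derive t 1 b 0.
  apply: (@derive1_at_min R b (t - 1) (t + 1)).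
  - by rewrite lerD2l; lra.
  - by move=> s _; have [] := db s _ (derivableP (cd s)).
  - by rewrite in_itv /= ltrBlDr !ltrDl ltr01.
  - move=> s _; rewrite {1}/b cE mulmxA mulVmx// mul1mx mulmxV// mxtrace1.
    have iVs : (invmx V)^T = invmx V by rewrite trmx_inv (SLP_sym VS).
    rewrite /b -[X in _ *m X]iVs; apply: SLP_trace_ge; apply: SLP_congruence => //.
    by rewrite det_inv VS.2 invr1 mulr1.
have := is_derive_unique (db t dc dct) bmin.
by rewrite mxtrace_mulC mulmxA => <-; rewrite cE invmx_mulmx.
Qed.

Lemma SLP_invmx A : SLP R n A -> invmx A = \adj A.
Proof.
by move=> SA; apply: mulmx1_invmx; rewrite mul_mx_adj SA.2.
Qed.

(** The adjugate shows that the derivative exists; its value follows by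
    differentiating the product of the inverse with the matrix. *)
Lemma is_derive_invmx (c : R -> 'M[R]_n) (t : R) dc :
  (forall s, SLP R n (c s)) -> is_derive t 1 c dc ->
  is_derive t 1 (fun s => invmx (c s)) (- (invmx (c t) *m dc *m invmx (c t))).
Proof.
move=> cS dct.
have [dadj _] := @Ck_adjugate R n 1.
have := is_derive_comp_curve (dadj (c t) I) dct.
rewrite (_ : _ \o _ = (fun s => invmx (c s))); last first.
  by apply/funext => s /=; rewrite SLP_invmx.
set J' := 'd _ _ _ => dJ.
have cu := SLP_unit (cS t).
have : is_derive t 1 (fun s => invmx (c s) *m c s) 0.
  rewrite (_ : (fun s => _) = cst 1%:M); first exact: is_derive_cst.
  by apply/funext => s; rewrite mulVmx// SLP_unit.
move=> /(is_derive_unique (is_derive_mulmx dJ dct)) /eqP.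
rewrite addr_eq0 => /eqP /(congr1 (mulmx^~ (invmx (c t)))) /=.
by rewrite mulNmx -(mulmxA J') mulmxV// mulmx1 => <-.
Qed.

(** Points, as elements of the type of the manifold. *)
Definition point A (SA : SLP R n A) : SLP R n := exist _ A (mem_set SA).

Lemma pointP (A : SLP R n) : SLP R n (val A).
Proof. exact: set_mem (valP A). Qed.

Lemma SLP_exp_congruence P X : \det P * \det P = 1 -> symm0 X ->
  SLP R n (P *m expmx X *m P^T).
Proof. by move=> dP Xs; apply: SLP_congruence => //; exact: expmx_SLP. Qed.

(** The geodesic through [P P^T] with velocity [P X P^T]. Every point is [P P^T]
    for many [P]; allowing all of them lets a geodesic be restarted from any of
    its points with the same [X]. *)
Definition geodesic P X (dP : \det P * \det P = 1) (Xs : symm0 X) (t : R) : SLP R n :=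
  point (SLP_exp_congruence dP (symm0_scale t Xs)).

Lemma tangent_congruence (A : SLP R n) P X : \det P * \det P = 1 -> symm0 X ->
  val A = P *m P^T -> tangent A (P *m X *m P^T).
Proof.
move=> dP Xs AE; exists (geodesic dP Xs), setT; split=> //.
- exact: openT.
- exact: (smooth_exp_curve P P^T setT Xs.1).
- by apply/val_inj; rewrite /= scale0r expmx0 mulmx1.
- rewrite derive1E; have [_ ->] := is_derive_exp_curve P P^T 0 Xs.1.
  by rewrite scale0r expmx0 mul1mx.
Qed.

End Manifold.

(** * Differentials applied to vector fields along curves *)

Section DerivativeAlongField.
Variables (R : realType) (n : nat).

Lemma is_derive_scale (V : normedModType R) (f : V -> R) (w : V -> 'M[R]_n) t v df dw :
  is_derive t v f df -> is_derive t v w dw ->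
  is_derive t v (fun s => f s *: w s) (df *: w t + f t *: dw).
Proof.
move=> Df /is_derive_mxP Dw; apply/is_derive_mxP => i j.
rewrite (_ : (fun s => _) = f * (fun s => w s i j)); last first.
  by apply/funext => s; rewrite mxE.
have /is_derive_eq := is_deriveM Df (Dw i j); apply.
by rewrite !mxE addrC; congr (_ + _); exact: mulrC.
Qed.

Lemma differential_entries (F : 'M[R]_n -> 'M[R]_n) x (w : 'M[R]_n) :
  differentiable F x -> 'd F x w = \sum_i \sum_j w i j *: 'D_(delta_mx i j) F x.
Proof.
move=> dF; rewrite {1}[w]matrix_sum_delta linear_sum; apply: eq_bigr => i _.
rewrite linear_sum; apply: eq_bigr => j _.
by rewrite linearZ deriveE.
Qed.

Lemma derivable_continuous_curve (V : normedModType R) (c : R -> V) t :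
  derivable c t 1 -> {for t, continuous c}.
Proof. by move=> /derivable1_diffP; exact: differentiable_continuous. Qed.

Lemma near_curve (V : normedModType R) (c : R -> V) t (U : set V) : open U -> U (c t) ->
  derivable c t 1 -> \forall s \near t, U (c s).
Proof.
move=> oU Ut /derivable_continuous_curve ct; apply: ct.
exact: open_nbhs_nbhs.
Qed.

(** Expanded in the matrix units, the left-hand side is a sum of products of
    entries of [v] with partial derivatives of [F] along the curve. *)
Lemma is_derive_differential (F : 'M[R]_n -> 'M[R]_n) (U : set 'M[R]_n)
    (c v : R -> 'M[R]_n) t dc dv :
  open U -> Ck_on 2 U F -> U (c t) -> is_derive t 1 c dc -> is_derive t 1 v dv ->
  is_derive t 1 (fun s => 'd F (c s) (v s))
    ('d F (c t) dv + 'D_dc ('D_(v t) F) (c t)).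
Proof.
move=> oU [dF dF2] Ut Dc Dv.
have dDF u x : U x -> differentiable ('D_u F) x by have [+ _] := dF2 u; apply.
have Un : \forall s \near t, U (c s) by apply: near_curve => //; case: Dc.
pose E i j : 'M[R]_n := delta_mx i j.
have D1 : is_derive t 1 (\sum_i \sum_j (fun s => v s i j *: 'D_(E i j) F (c s)))
    (\sum_i \sum_j (dv i j *: 'D_(E i j) F (c t) + v t i j *: 'D_dc ('D_(E i j) F) (c t))).
  apply: is_derive_sum => i; apply: is_derive_sum => j; apply: is_derive_scale.
    by move/is_derive_mxP: Dv.
  rewrite deriveE; last exact: dDF.
  by apply: is_derive_comp_curve => //; exact: dDF.
have D2 : is_derive (c t) dc (\sum_i \sum_j (fun x => v t i j *: 'D_(E i j) F x))
    (\sum_i \sum_j (v t i j *: 'D_dc ('D_(E i j) F) (c t))).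
  apply: is_derive_sum => i; apply: is_derive_sum => j.
  by apply: is_deriveZ; apply: derivableP; apply: diff_derivable; exact: dDF.
have E2 : 'D_dc ('D_(v t) F) (c t) =
    \sum_i \sum_j (v t i j *: 'D_dc ('D_(E i j) F) (c t)).
  case: D2 => _ <-; apply: near_eq_derive.
  have : \forall x \near c t, U x by exact: open_nbhs_nbhs.
  apply: filterS => x Ux; rewrite (deriveE _ (dF x Ux)) (differential_entries _ (dF x Ux)).
  by rewrite !fct_sumE; apply: eq_bigr => i _; rewrite fct_sumE.
have E1 := differential_entries dv (dF _ Ut).
suff D3 : is_derive t 1 (fun s => 'd F (c s) (v s))
    (\sum_i \sum_j (dv i j *: 'D_(E i j) F (c t) + v t i j *: 'D_dc ('D_(E i j) F) (c t))).
  apply: (is_derive_eq D3); rewrite E1 E2 -big_split; apply: eq_bigr => i _.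
  by rewrite -big_split.
apply: near_eq_is_derive D1; apply: filterS Un => s Us.
rewrite (differential_entries _ (dF _ Us)).
by rewrite !fct_sumE; apply: eq_bigr => i _; rewrite fct_sumE.
Qed.
End DerivativeAlongField.

(** * The differential of an isometry preserves the connection *)

Section CurveImages.
Variables (R : realType) (n : nat) (G : SLP R n -> SLP R n).

(** Near the parameter [t] the image curve is the composition with the smooth
    extension, so its velocity is given by the differential of any extension. *)
Lemma is_derive_image (p : R -> SLP R n) t V F :
  smooth_extension G (p t) F -> is_derive t 1 (fun s => val (p s)) V ->
  is_derive t 1 (fun s => val (G (p s))) ('d F (val (p t)) V).
Proof.
move=> [U [oU Ut FU FG]] dp; have [dF _] := FU 1.
have := is_derive_comp_curve (dF _ Ut) dp; apply: near_eq_is_derive.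
have : \forall s \near t, U (val (p s)).
  by apply: (near_curve (c := fun s => val (p s))) => //; case: dp.
by apply: filterS => s Us; exact: FG.
Qed.

Lemma derivable_image (p : R -> SLP R n) t : smooth_map G ->
  derivable (fun s => val (p s)) t 1 -> derivable (fun s => val (G (p s))) t 1.
Proof.
move=> Gs dp; have [F FP] := Gs (p t).
by have [] := is_derive_image FP (derivableP dp).
Qed.
End CurveImages.

Lemma trace_product_derivative (R : realType) n (J y w z sw sz : 'M[R]_n) :
  \tr (((- (J *m y *m J) *m w + J *m sw) *m J + (J *m w) *m - (J *m y *m J)) *m z
        + J *m w *m J *m sz) =
  \tr (J *m sw *m J *m z) + \tr (J *m w *m J *m sz)
  - \tr (J *m y *m J *m w *m J *m z) - \tr (J *m w *m J *m y *m J *m z).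
Proof.
rewrite !mulmxDl !mulmxN !mulNmx !mulmxA !mxtraceD !raddfN /=.
move: (\tr _) (\tr _) (\tr _) (\tr _) => a b c d; ring.
Qed.

(** The point [A] is [P P^T]. Tangent vectors at [A] are the [P W P^T] with [W]
    traceless symmetric, and [L W] is the image of such a vector, so that
    [q (L W) (L Z)] is the metric at [G A]. Along the geodesic in the direction
    [Y], [frame *m frame^T] is the point, [transport] the parallel field
    with initial value [P W P^T], [b] the image of this field, and [S] the
    derivative of [b] at time 0. *)
Section SecondOrder.
Variables (R : realType) (n : nat) (G H : SLP R n -> SLP R n).
Hypothesis GK : cancel G H.
Hypothesis HK : cancel H G.
Hypothesis Gs : smooth_map G.
Hypothesis Hs : smooth_map H.
Hypothesis Gm : preserves_metric G.

Variables (P : 'M[R]_n) (A : SLP R n) (F : 'M[R]_n -> 'M[R]_n) (U : set 'M[R]_n).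
Hypothesis dP : \det P * \det P = 1.
Hypothesis AE : val A = P *m P^T.
Hypothesis oU : open U.
Hypothesis UA : U (val A).
Hypothesis FU : smooth_on U F.
Hypothesis FG : forall B : SLP R n, U (val B) -> F (val B) = val (G B).
Implicit Types X Y Z W N : 'M[R]_n.

Let J := invmx (val (G A)).
Let L W := 'd F (val A) (P *m W *m P^T).

Let frame Y (t : R) := P *m expmx (t *: (2^-1 *: Y)).

Let det_exp Y t : symm0 Y -> \det (expmx (t *: Y)) = 1.
Proof. by move=> Ys; have [] := expmx_SLP (symm0_scale t Ys). Qed.

Let det_frame Y t : symm0 Y -> \det (frame Y t) * \det (frame Y t) = 1.
Proof. by move=> Ys; rewrite det_mulmx det_exp ?mulr1//; exact: symm0_scale. Qed.

Let frameE Y t W : symm0 Y -> frame Y t *m W *m (frame Y t)^T =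
  P *m (expmx (t *: (2^-1 *: Y)) *m W *m expmx (t *: (2^-1 *: Y))) *m P^T.
Proof. by move=> Ys; rewrite /frame trmx_mul expmx_sym !mulmxA. Qed.

Let half_sqr Y (t : R) : symm0 Y ->
  expmx (t *: (2^-1 *: Y)) *m expmx (t *: (2^-1 *: Y)) = expmx (t *: Y).
Proof.
move=> Ys; rewrite -expmxD; last exact: (symm0_scale 2^-1 Ys).1.
by rewrite scalerA; have -> : (t + t) * 2^-1 = t by field.
Qed.

Let frame_sqr Y t : symm0 Y -> frame Y t *m (frame Y t)^T = P *m expmx (t *: Y) *m P^T.
Proof.
move=> Ys; have := frameE t 1%:M Ys; by rewrite !mulmx1 => ->; rewrite half_sqr.
Qed.

Let geo Y (Ys : symm0 Y) := geodesic dP Ys.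

Let geo0 Y (Ys : symm0 Y) : geo Ys 0 = A.
Proof. by apply/val_inj; rewrite /= scale0r expmx0 mulmx1 AE. Qed.

Let is_derive_geo Y (Ys : symm0 Y) (t : R) : is_derive t 1 (fun s => val (geo Ys s))
  (frame Y t *m Y *m (frame Y t)^T).
Proof.
have := is_derive_exp_curve P P^T t Ys.1.
move/is_derive_eq; apply; rewrite frameE//; congr (_ *m _ *m _).
have EY : expmx (t *: (2^-1 *: Y)) *m Y = Y *m expmx (t *: (2^-1 *: Y)).
  apply: expmx_comm; first exact: (symm0_scale t (symm0_scale 2^-1 Ys)).1.
  by rewrite -!scalemxAl -!scalemxAr.
by rewrite -mulmxA -EY mulmxA half_sqr.
Qed.

Let near_geo Y (Ys : symm0 Y) : \forall t \near (0 : R), U (val (geo Ys t)).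
Proof.
have Ug : U (val (geo Ys 0)) := eq_ind_r (fun B => U (val B)) UA (geo0 Ys).
have [dg _] := is_derive_geo Ys 0.
exact: (@near_curve R _ (fun s => val (geo Ys s)) 0 U oU Ug dg).
Qed.

Let transport Y W (t : R) := frame Y t *m W *m (frame Y t)^T.
Let b Y W (t : R) := 'd F (P *m expmx (t *: Y) *m P^T) (transport Y W t).
Let S Y W := 'd F (val A) (P *m (2^-1 *: (Y *m W + W *m Y)) *m P^T)
  + 'D_(P *m Y *m P^T) ('D_(P *m W *m P^T) F) (val A).

Let transport0 Y W : symm0 Y -> transport Y W 0 = P *m W *m P^T.
Proof. by move=> Ys; rewrite /transport frameE// !scale0r expmx0 mul1mx mulmx1. Qed.

Let b0 Y W : symm0 Y -> b Y W 0 = L W.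
Proof.
move=> Ys; rewrite /b (transport0 W Ys).
have -> : P *m expmx (0 *: Y) *m P^T = val A by rewrite scale0r expmx0 mulmx1 AE.
by [].
Qed.

Let is_derive_transport Y W : symm0 Y ->
  is_derive (0 : R) 1 (transport Y W) (P *m (2^-1 *: (Y *m W + W *m Y)) *m P^T).
Proof.
move=> Ys; have hs : (2^-1 *: Y)^T = 2^-1 *: Y by exact: (symm0_scale 2^-1 Ys).1.
rewrite (_ : transport Y W = fun t => P *m
    (expmx (t *: (2^-1 *: Y)) *m W *m expmx (t *: (2^-1 *: Y))) *m P^T); last first.
  by apply/funext => t; exact: frameE.
apply: is_derive_mulmx_cst.
have dE := is_derive_expmx 0 hs; rewrite scale0r expmx0 mul1mx in dE.
have := is_derive_mulmx (is_derive_mulmx dE (is_derive_cst W (0 : R) 1)) dE.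
move/is_derive_eq; apply; rewrite scale0r expmx0 !mulmx1 mulmx0 addr0 mul1mx.
by rewrite -scalemxAl -scalemxAr -scalerDr.
Qed.

Let is_derive_b Y W : symm0 Y -> is_derive (0 : R) 1 (b Y W) (S Y W).
Proof.
move=> Ys; have := @is_derive_differential R n F U (fun s => val (geo Ys s))
  (transport Y W) 0 _ _ oU (FU 2) _ (is_derive_geo Ys 0) (is_derive_transport W Ys).
rewrite geo0 => /(_ UA); rewrite -[frame Y 0 *m Y *m _]/(transport Y Y 0).
by rewrite !transport0.
Qed.

(** Second derivatives commute, and [Y W + W Y] is symmetric in [Y] and [W]: this
    is the absence of torsion. *)
Let S_sym Y W : S Y W = S W Y.
Proof.
have E1 := addrC (Y *m W) (W *m Y).
have E2 := mixed_derivatives_commute_mx (P *m W *m P^T) (P *m Y *m P^T) oU UA (FU 2).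
exact: (f_equal2 +%R (f_equal (fun M => 'd F (val A) (P *m (2^-1 *: M) *m P^T)) E1) E2).
Qed.

Let is_derive_image_geo Y (Ys : symm0 Y) (t : R) : U (val (geo Ys t)) ->
  is_derive t 1 (fun s => val (G (geo Ys s))) (b Y Y t).
Proof.
move=> Ut; have ext : smooth_extension G (geo Ys t) F by exists U.
exact: (is_derive_image ext (is_derive_geo Ys t)).
Qed.

Let metric Y W Z t (Ys : symm0 Y) : symm0 W -> symm0 Z -> U (val (geo Ys t)) ->
  trace_metric (val (G (geo Ys t))) (b Y W t) (b Y Z t) = \tr (W *m Z).
Proof.
move=> Ws Zs Ut; have ext : smooth_extension G (geo Ys t) F by exists U.
have pE : val (geo Ys t) = frame Y t *m (frame Y t)^T by rewrite frame_sqr.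
have dr := det_frame t Ys.
have tW := tangent_congruence dr Ws pE; have tZ := tangent_congruence dr Zs pE.
have E := Gm ext tW tZ.
have E2 := trace_metric_frame W Z (det_pm1_unit dr).
by rewrite -E2 -pE -E.
Qed.

Let tr4 (C D E : 'M[R]_n) := \tr (J *m C *m J *m D *m J *m E).

Let metric_derivative Y W Z : symm0 Y -> symm0 W -> symm0 Z ->
  \tr (J *m S Y W *m J *m L Z) + \tr (J *m L W *m J *m S Y Z)
  = tr4 (L Y) (L W) (L Z) + tr4 (L W) (L Y) (L Z).
Proof.
move=> Ys Ws Zs; have U0 : U (val (geo Ys 0)) by rewrite geo0.
pose c s := val (G (geo Ys s)).
have c0 : c 0 = val (G A) by rewrite /c geo0.
have dJ := is_derive_invmx (fun s => pointP (G (geo Ys s))) (is_derive_image_geo U0).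
have dW := is_derive_b W Ys; have dZ := is_derive_b Z Ys.
have D := is_derive_mxtrace (is_derive_mulmx (is_derive_mulmx (is_derive_mulmx dJ dW) dJ) dZ).
have D0 : is_derive (0 : R) 1 (fun s => trace_metric (c s) (b Y W s) (b Y Z s)) 0.
  have D1 : is_derive (0 : R) 1 (cst (\tr (W *m Z)) : R -> R) 0 := is_derive_cst _ _ _.
  apply: (near_eq_is_derive _ D1).
  by apply: filterS (near_geo Ys) => s Us; exact/esym/metric.
have := is_derive_unique D D0.
rewrite -/(c 0) c0 -/J !b0// trace_product_derivative.
by move=> E; apply/eqP; rewrite -subr_eq0 opprD addrA; apply/eqP.
Qed.

Let q (C D : 'M[R]_n) := \tr (J *m C *m J *m D).

Let q_sym C D : q C D = q D C.
Proof. by rewrite /q -mulmxA mxtrace_mulC mulmxA. Qed.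

Let qDl C D E : q (C + D) E = q C E + q D E.
Proof. by rewrite /q mulmxDr !mulmxDl mxtraceD. Qed.

Let qZl a C D : q (a *: C) D = a * q C D.
Proof. by rewrite /q -scalemxAr -!scalemxAl mxtraceZ. Qed.

Let q_tr4 C D E : q (C *m J *m D) E = tr4 C D E.
Proof. by rewrite /q /tr4 !mulmxA. Qed.

Let tr4_cycle C D E : tr4 C D E = tr4 D E C.
Proof.
rewrite /tr4; have -> : J *m C *m J *m D *m J *m E = (J *m C) *m (J *m D *m J *m E).
  by rewrite !mulmxA.
by rewrite mxtrace_mulC !mulmxA.
Qed.

(** The Levi-Civita connection of the trace metric at [B] is the directional
    derivative of matrix fields minus [1/2 (V B^-1 W + W B^-1 V)]. Hence [N Y W]
    is the covariant derivative of the image of a parallel field. *)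
Let N Y W := S Y W + (- 2^-1) *: (L Y *m J *m L W + L W *m J *m L Y).

Let N_sym Y W : N Y W = N W Y.
Proof. by rewrite /N S_sym [L Y *m J *m L W + _]addrC. Qed.

Let qN Y W Z : q (N Y W) (L Z) =
  q (S Y W) (L Z) + - 2^-1 * (tr4 (L Y) (L W) (L Z) + tr4 (L W) (L Y) (L Z)).
Proof. by rewrite /N (qDl (S Y W)) qZl (qDl (L Y *m J *m L W)) !q_tr4. Qed.

(** The metric is constant along the images of parallel fields, because it is so
    along the fields themselves. *)
Let N_skew Y W Z : symm0 Y -> symm0 W -> symm0 Z ->
  q (N Y W) (L Z) + q (N Y Z) (L W) = 0.
Proof.
move=> Ys Ws Zs; rewrite !qN.
have arith (a c d e : R) : a + c = d + e ->
    a + - 2^-1 * (d + e) + (c + - 2^-1 * (e + d)) = 0.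
  move=> E; have -> : a + - 2^-1 * (d + e) + (c + - 2^-1 * (e + d)) = a + c - (d + e).
    by field.
  by rewrite E subrr.
have := metric_derivative Ys Ws Zs; rewrite -/(q (S Y W) (L Z)) -/(q (L W) (S Y Z)).
rewrite (q_sym (L W) (S Y Z)) (tr4_cycle (L Y) (L Z) (L W)) (tr4_cycle (L Z) (L W) (L Y)).
rewrite (tr4_cycle (L Z) (L Y) (L W)).
exact: arith.
Qed.

(** The form [q (N Y W) (L Z)] is symmetric in [Y, W] and skew in [W, Z], which
    forces it to vanish. *)
Let N_perp X W : symm0 X -> symm0 W -> q (N X X) (L W) = 0.
Proof.
move=> Xs Ws; have E1 := N_skew Xs Xs Ws; have E2 := N_skew Ws Xs Xs.
rewrite (N_sym X W) in E1.
have arith (a c : R) : a + c = 0 -> c + c = 0 -> a = 0 by lra.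
exact: arith E1 E2.
Qed.

(** The inverse map pulls the geodesic with velocity [M] back to a smooth curve
    through [A], whose velocity is the required preimage. *)
Let L_onto M : M^T = M -> \tr (J *m M) = 0 -> exists2 W, symm0 W & L W = M.
Proof.
move=> Ms Mt; have [V VS VE] := SLP_sqrt (pointP (G A)); have Vu := SLP_unit VS.
have VT := SLP_sym VS.
have dV : \det V * \det V = 1 by rewrite VS.2 mulr1.
have JE : J = invmx V *m invmx V by rewrite /J VE invmx_mulmx.
pose K := invmx V *m M *m invmx V.
have Ks : symm0 K.
  split; first by rewrite /K !trmx_mul trmx_inv VT Ms mulmxA.
  by rewrite /K mxtrace_mulC mulmxA -JE.
pose a t := H (geodesic dV Ks t).
have g0 : geodesic dV Ks 0 = G A.
  by apply/val_inj; rewrite /= scale0r expmx0 mulmx1 VT -VE.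
have a0 : a 0 = A by rewrite /a g0 GK.
have dg t : derivable (fun s => val (geodesic dV Ks s)) t 1.
  by have [] := is_derive_exp_curve V V^T t Ks.1.
have da t : derivable (fun s => val (a s)) t 1 := derivable_image Hs (dg t).
have [Q Q0] : exists Q, is_derive (0 : R) 1 (fun s => val (a s)) Q.
  by eexists; exact: derivableP (da 0).
have [Qs Qt] := SLP_velocity (fun s => pointP (a s)) da Q0.
rewrite a0 AE in Qt.
have Pu := det_pm1_unit dP.
have iPP : invmx (P *m P^T) = (invmx P)^T *m invmx P.
  by rewrite invmx_mulmx ?unitmx_tr// trmx_inv.
exists (invmx P *m Q *m (invmx P)^T).
  split; first by rewrite !trmx_mul trmxK Qs mulmxA.
  by rewrite mxtrace_mulC mulmxA -iPP.
have ext : smooth_extension G (a 0) F by exists U; rewrite a0.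
have D1 := is_derive_image ext Q0.
have D2 : is_derive (0 : R) 1 (fun s => val (G (a s))) M.
  rewrite (_ : (fun s => _) = (fun s => V *m expmx (s *: K) *m V^T)); last first.
    by apply/funext => s; rewrite /a HK.
  have /is_derive_eq := is_derive_exp_curve V V^T 0 Ks.1; apply.
  by rewrite scale0r expmx0 mul1mx VT /K mulmx_conjK.
rewrite -(is_derive_unique D1 D2) a0 /L; congr ('d F (val A) _).
rewrite !mulmxA mulmxV// mul1mx -mulmxA -trmx_mul mulmxV// trmx1 mulmx1.
by [].
Qed.

Let near_velocity X (Xs : symm0 X) : \forall t \near (0 : R),
  is_derive (t : R) 1 (fun s => val (G (geo Xs s))) (b X X t).
Proof. by apply: filterS (near_geo Xs) => t Ut; exact: is_derive_image_geo. Qed.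

Let derivable_geo_image X (Xs : symm0 X) (t : R) :
  derivable (fun s => val (G (geo Xs s))) t 1.
Proof. by apply: derivable_image => //; have [] := is_derive_geo Xs t. Qed.

Let near_tangent X (Xs : symm0 X) : \forall t \near (0 : R),
  (b X X t)^T = b X X t /\ \tr (invmx (val (G (geo Xs t))) *m b X X t) = 0.
Proof.
apply: filterS (near_velocity Xs) => t Dt.
have V := SLP_velocity (fun s => pointP (G (geo Xs s))) (@derivable_geo_image X Xs) Dt.
by split; [exact: V.1|exact: V.2].
Qed.

(** [N X X] is tangent at the image point, hence of the form [L W], and it is
    orthogonal to all such vectors. *)
Let N_zero X : symm0 X -> S X X = L X *m J *m L X.
Proof.
move=> Xs; have dS := is_derive_b X Xs.
have SS : (S X X)^T = S X X.
  have D : is_derive (0 : R) 1 (b X X) (S X X)^T.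
    apply: (near_eq_is_derive _ (is_derive_trmx dS)).
    by apply: filterS (near_tangent Xs) => t [].
  exact: is_derive_unique D dS.
have [LT _] : (L X)^T = L X /\ \tr (invmx (val (G (geo Xs 0))) *m b X X 0) = 0.
  by rewrite -(b0 X Xs); exact: (nbhs_singleton (near_tangent Xs)).
have JT : J^T = J by rewrite trmx_inv (SLP_sym (pointP _)).
have U0 : U (val (geo Xs 0)) by rewrite geo0.
have St : \tr (J *m (S X X - L X *m J *m L X)) = 0.
  have dJ := is_derive_invmx (fun s => pointP (G (geo Xs s))) (is_derive_image_geo U0).
  have D := is_derive_mxtrace (is_derive_mulmx dJ dS).
  have D1 : is_derive (0 : R) 1 (cst 0 : R -> R) 0 := is_derive_cst _ _ _.
  have D0 : is_derive (0 : R) 1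
      (fun s => \tr (invmx (val (G (geo Xs s))) *m b X X s)) 0.
    apply: (near_eq_is_derive _ D1).
    by apply: filterS (near_tangent Xs) => t [].
  have := is_derive_unique D D0; rewrite geo0 -/J (b0 X Xs) => <-.
  by rewrite mulmxBr mulNmx !mulmxA addrC.
have NE : N X X = S X X - L X *m J *m L X.
  have half (M : 'M[R]_n) : - 2^-1 *: (M + M) = - M.
    by apply/matrixP => i j; rewrite !mxE; field.
  by rewrite /N half.
have NT : (S X X - L X *m J *m L X)^T = S X X - L X *m J *m L X.
  by rewrite linearB /= SS !trmx_mul LT JT mulmxA.
have [W Ws LW] := L_onto NT St.
have := N_perp Xs Ws; rewrite NE LW /q => q0.
apply/eqP; rewrite -subr_eq0; apply/eqP; move: q0 NT.
move: (S X X - _) => M q0 Ms.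
have [V VS VE] := SLP_sqrt (pointP (G A)); have Vu := SLP_unit VS.
have VT := SLP_sym VS.
have JE : J = invmx V *m invmx V by rewrite /J VE invmx_mulmx.
pose K := invmx V *m M *m invmx V.
have KT : K^T = K by rewrite /K !trmx_mul trmx_inv VT Ms mulmxA.
have K0 : K = 0.
  apply: sqnorm_eq0; rewrite KT -q0 JE /K !mulmxA.
  by rewrite [LHS]mxtrace_mulC !mulmxA.
by rewrite -(mulmx_conjK M Vu) -/K K0 mulmx0 mul0mx.
Qed.

(** The acceleration of the image curve is [S X X], and [N_zero] says that it is
    the one prescribed by the geodesic equation [c'' = c' c^-1 c']. *)
Lemma geodesic_acceleration X (Xs : symm0 X) :
  let c t := val (G (geodesic dP Xs t)) in
  'D_1 c (0 : R) = 'd F (val A) (P *m X *m P^T) /\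
  is_derive (0 : R) 1 ('D_1 c) ('D_1 c (0 : R) *m invmx (c 0) *m 'D_1 c (0 : R)).
Proof.
move=> c.
have c'E : \forall t \near (0 : R), b X X t = 'D_1 c t.
  by apply: filterS (near_velocity Xs) => t [_ <-].
have c0 : 'D_1 c (0 : R) = L X by rewrite -(nbhs_singleton c'E) b0.
split; first exact: c0.
have -> : invmx (c 0) = J by rewrite /c -[geodesic dP Xs 0]/(geo Xs 0) geo0.
rewrite c0 -N_zero//; exact: (near_eq_is_derive c'E (is_derive_b X Xs)).
Qed.

Lemma differential_isometry X Y : symm0 X -> symm0 Y ->
  trace_metric (val (G A)) ('d F (val A) (P *m X *m P^T)) ('d F (val A) (P *m Y *m P^T))
  = \tr (X *m Y).
Proof.
move=> Xs Ys; have ext : smooth_extension G A F by exists U.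
rewrite (Gm ext (tangent_congruence dP Xs AE) (tangent_congruence dP Ys AE)) AE.
exact: trace_metric_frame (det_pm1_unit dP).
Qed.

Lemma differential_onto M : M^T = M -> \tr (invmx (val (G A)) *m M) = 0 ->
  exists2 W, symm0 W & 'd F (val A) (P *m W *m P^T) = M.
Proof. exact: L_onto. Qed.

End SecondOrder.

(** * Isometries map geodesics to geodesics *)

Section Geodesics.
Variables (R : realType) (n : nat).
Implicit Types X V P : 'M[R]_n.

Lemma growth_rate_shift (W : normedModType R) (f : R -> W) (a t : R) :
  (fun h : R => h^-1 *: (((fun s => f (s + a)) \o shift t) (h *: (1 : R)) - f (t + a))) =
  (fun h : R => h^-1 *: ((f \o shift (t + a)) (h *: (1 : R)) - f (t + a))).
Proof. by apply/funext => h /=; rewrite addrA. Qed.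

Lemma derive_shift_curve (W : normedModType R) (f : R -> W) (a t : R) :
  'D_1 (fun s => f (s + a)) t = 'D_1 f (t + a).
Proof. by rewrite /derive growth_rate_shift. Qed.

Lemma is_derive_shift_curve (W : normedModType R) (f : R -> W) (a t : R) v :
  is_derive (t + a) 1 f v -> is_derive t 1 (fun s => f (s + a)) v.
Proof.
move=> [df fv]; split; last by rewrite derive_shift_curve.
by move: df; rewrite /derivable growth_rate_shift.
Qed.

Lemma derive0_cst (f : R -> 'M[R]_n) (t : R) : (forall s : R, is_derive s 1 f 0) -> f t = f 0.
Proof.
move=> f0; apply/matrixP => i j.
apply: (@is_derive_0_is_cst R (fun s => f s i j)) => s.
by have /is_derive_mxP/(_ i j) := f0 s; rewrite mxE.
Qed.

(** The velocity of a solution of the geodesic equation is a constant multiple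
    of its position, as [c^-1 c'] has derivative zero. *)
Lemma geodesic_equation (c : R -> 'M[R]_n) V :
  (forall t, SLP R n (c t)) -> (forall t : R, derivable c t 1) ->
  (forall t : R, is_derive t 1 ('D_1 c) ('D_1 c t *m invmx (c t) *m 'D_1 c t)) ->
  SLP R n V -> c 0 = V *m V ->
  let K := invmx V *m 'D_1 c 0 *m invmx V in
  symm0 K /\ forall t, c t = V *m expmx (t *: K) *m V.
Proof.
move=> cS cd c2 VS c0 K; have Vu := SLP_unit VS; have VT := SLP_sym VS.
have dc (t : R) : is_derive t 1 c ('D_1 c t) := derivableP (cd t).
pose k t := invmx (c t) *m 'D_1 c t.
have k0 t : k t = k 0.
  apply: derive0_cst => s; have := is_derive_mulmx (is_derive_invmx cS (dc s)) (c2 s).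
  by rewrite mulNmx !mulmxA addNr.
have c'E t : 'D_1 c t = c t *m k 0.
  by rewrite -(k0 t) /k mulmxA mulmxV ?mul1mx// SLP_unit.
have JE : invmx (c 0) = invmx V *m invmx V by rewrite c0 invmx_mulmx.
have KE : k 0 *m invmx V = invmx V *m K by rewrite /k JE /K !mulmxA.
move: (k 0) c'E KE => k1 c'E KE {k0}.
have [DT Dt] := SLP_velocity cS cd (dc 0).
have Ks : symm0 K.
  split; first by rewrite /K !trmx_mul trmx_inv VT DT mulmxA.
  by rewrite /K mxtrace_mulC mulmxA -JE.
clearbody K; split=> // t; pose e s := invmx V *m c s *m invmx V *m expmx (s *: (- K)).
have NKs : symm0 (- K) by rewrite -scaleN1r; exact: symm0_scale.
have e1 : e t = 1%:M.
  have -> : e t = e 0.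
    apply: derive0_cst => s.
    have D1 := is_derive_mulmx_cst (invmx V) (invmx V) (dc s).
    have /is_derive_eq := is_derive_mulmx D1 (is_derive_expmx s NKs.1); apply.
    have -> : expmx (s *: - K) *m - K = - K *m expmx (s *: - K).
      apply: expmx_comm; first exact: (symm0_scale s NKs).1.
      by rewrite -scalemxAl -scalemxAr.
    have -> : invmx V *m 'D_1 c s *m invmx V = invmx V *m c s *m invmx V *m K.
      by rewrite c'E -!mulmxA KE.
    by rewrite mulNmx mulmxN !mulmxA subrr.
  by rewrite /e scale0r expmx0 mulmx1 c0 mulmxA mulVmx// mul1mx mulmxV.
have : invmx V *m c t *m invmx V = expmx (t *: K).
  have KK := expmxN (symm0_scale t Ks).1; rewrite -[LHS]mulmx1 -KK mulmxA.
  by move: e1; rewrite /e scalerN => ->; rewrite mul1mx.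
by move=> <-; rewrite mulmx_conjK.
Qed.

Section Image.
Variables G H : SLP R n -> SLP R n.
Hypothesis GK : cancel G H.
Hypothesis HK : cancel H G.
Hypothesis Gs : smooth_map G.
Hypothesis Hs : smooth_map H.
Hypothesis Gm : preserves_metric G.

Let acceleration P X (dP : \det P * \det P = 1) (Xs : symm0 X) A F :
  val A = P *m P^T -> smooth_extension G A F ->
  let c t := val (G (geodesic dP Xs t)) in
  'D_1 c (0 : R) = 'd F (val A) (P *m X *m P^T) /\
  is_derive (0 : R) 1 ('D_1 c) ('D_1 c (0 : R) *m invmx (c 0) *m 'D_1 c (0 : R)).
Proof.
move=> AE [U [oU UA FU FG]].
exact: (geodesic_acceleration GK HK Gs Hs Gm dP AE oU UA FU FG).
Qed.

(** The geodesic equation is known at time 0 for every starting point; moving the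
    starting point along the geodesic gives it at all times. *)
Theorem isometry_geodesic P X (dP : \det P * \det P = 1) (Xs : symm0 X) A F V :
  val A = P *m P^T -> smooth_extension G A F ->
  SLP R n V -> val (G A) = V *m V ->
  let K := invmx V *m 'd F (val A) (P *m X *m P^T) *m invmx V in
  symm0 K /\ forall t, val (G (geodesic dP Xs t)) = V *m expmx (t *: K) *m V.
Proof.
move=> AE ext VS GV; pose c t := val (G (geodesic dP Xs t)).
have g0 : geodesic dP Xs 0 = A.
  by apply/val_inj; rewrite /= scale0r expmx0 mulmx1.
have cd (t : R) : derivable c t 1.
  apply: (derivable_image (p := geodesic dP Xs)) => //.
  by have [] := is_derive_exp_curve P P^T t Xs.1.
have c0 : c 0 = V *m V by rewrite /c g0.
have [D0 _] := acceleration dP Xs AE ext; rewrite -D0.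
apply: (geodesic_equation (c := c)) => // [t|t]; first exact: pointP.
(* At time [t] the same geodesic is reparametrized to start from its point
   [P0 P0^T], where the equation at time 0 applies. *)
pose P0 := P *m expmx (t *: (2^-1 *: X)).
have hs := symm0_scale 2^-1 Xs.
have d0 : \det P0 * \det P0 = 1.
  by rewrite det_mulmx (expmx_SLP (symm0_scale t hs)).2 mulr1.
have two r : expmx (r *: X) = expmx ((r + r) *: (2^-1 *: X)).
  by rewrite scalerA; have -> : (r + r) * 2^-1 = r by field.
have gE s : geodesic d0 Xs s = geodesic dP Xs (s + t).
  apply/val_inj; rewrite /= /P0 trmx_mul expmx_sym !two !mulmxA.
  rewrite -(mulmxA P) -expmxD ?hs.1// -(mulmxA P) -expmxD ?hs.1//.
  by congr (P *m expmx (_ *: _) *m _); ring.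
have A0E : val (geodesic dP Xs t) = P0 *m P0^T.
  by rewrite /= /P0 trmx_mul expmx_sym two expmxD ?hs.1// !mulmxA.
have [F0 ext0] := Gs (geodesic dP Xs t).
pose c1 s := val (G (geodesic d0 Xs s)).
have c1E s : c1 s = c (s + t) by rewrite /c1 gE.
have D1 : is_derive (0 : R) 1 ('D_1 c1)
    ('D_1 c1 (0 : R) *m invmx (c1 0) *m 'D_1 c1 (0 : R)).
  exact: (proj2 (acceleration d0 Xs A0E ext0)).
have cE : c = (fun s => c1 (s + - t)) by apply/funext => s; rewrite c1E subrK.
have Dc s : 'D_1 c s = 'D_1 c1 (s - t) by rewrite cE derive_shift_curve.
rewrite c1E add0r in D1.
have E0 : 'D_1 c1 (0 : R) = 'D_1 c t by rewrite Dc subrr.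
rewrite E0 in D1.
have DcE : (fun s => 'D_1 c1 (s + - t)) = 'D_1 c by apply/funext => s; rewrite Dc.
by rewrite -(subrr t) in D1; have := is_derive_shift_curve D1; rewrite DcE.
Qed.
End Image.
End Geodesics.

(** * From geodesic symmetries to the classification *)

Section TripleMaps.
Variables (R : realType) (n : nat).
Implicit Types A B C : SLP R n.

(** Maps compatible with the symmetric-space structure, normalized at the
    identity. *)
Definition triple_map (f : SLP R n -> SLP R n) :=
  f (SLP1 R n) = SLP1 R n /\
  forall A B C, val C = val A *m val B *m val A ->
    val (f C) = val (f A) *m val (f B) *m val (f A).

Lemma triple_map_inverse f h : cancel f h -> cancel h f -> triple_map f -> triple_map h.
Proof.
move=> fK hK [f1 ft]; split; first by rewrite -{1}f1 fK.
move=> A B C CE.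
have SD : SLP R n (val (h A) *m val (h B) *m val (h A)).
  rewrite -{2}(SLP_sym (pointP (h A))); apply: SLP_congruence; last exact: pointP.
  by rewrite (pointP (h A)).2 mulr1.
have := ft (h A) (h B) (point SD) erefl; rewrite !hK -CE => fD.
by rewrite (_ : C = f (point SD)) ?fK//; apply: val_inj.
Qed.

(** [Q] and its transpose have the same norm, so equality holds in the
    Cauchy-Schwarz inequality. *)
Lemma symmetric_of_trace (Q : 'M[R]_n) : \tr (Q *m Q) = \tr (Q *m Q^T) -> Q = Q^T.
Proof.
move=> E; apply/eqP; rewrite -subr_eq0; apply/eqP; apply: sqnorm_eq0.
have E2 : \tr (Q^T *m Q^T) = \tr (Q *m Q) by rewrite -trmx_mul mxtrace_tr.
have -> : (Q - Q^T)^T = Q^T - Q by rewrite linearB /= trmxK.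
rewrite mulmxBl !mulmxBr !raddfB /= E2 E (mxtrace_mulC Q^T Q).
by rewrite !subrr addr0.
Qed.

(** With [Q = c^-1 a c], the hypothesis says [Q Q^T = a^2], so that [Q] and [Q^T]
    have the same squared norm and scalar product, hence are equal. *)
Lemma swap_squares_commute (a c : 'M[R]_n) : a^T = a -> c^T = c -> c \in unitmx ->
  a *m (c *m c) *m a = c *m (a *m a) *m c -> a *m (c *m c) = (c *m c) *m a.
Proof.
move=> aT cT cu E; pose Q := invmx c *m a *m c.
have icT : (invmx c)^T = invmx c by rewrite trmx_inv cT.
have QT : Q^T = c *m a *m invmx c by rewrite /Q !trmx_mul icT aT cT mulmxA.
have QQT : Q *m Q^T = a *m a.
  have -> : Q *m Q^T = invmx c *m (a *m (c *m c) *m a) *m invmx c.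
    by rewrite QT /Q !mulmxA.
  by rewrite E !mulmxA mulVmx// mul1mx -mulmxA mulmxV// mulmx1.
have tQQ : \tr (Q *m Q) = \tr (a *m a).
  rewrite /Q !mulmxA -(mulmxA _ c (invmx c)) mulmxV// mulmx1 mxtrace_mulC.
  by rewrite !mulmxA mulmxV// mul1mx.
have : Q = Q^T by apply: symmetric_of_trace; rewrite QQT tQQ.
rewrite QT /Q => /(congr1 (fun M => c *m M *m c)) /=.
by rewrite !mulmxA mulmxV// mul1mx -(mulmxA _ (invmx c) c) mulVmx// mulmx1 => ->.
Qed.

(** If [A] and [C] commute then [A C^2 A = C A^2 C], and this identity passes to
    the images. *)
Lemma triple_map_commute f A C : triple_map f -> val A *m val C = val C *m val A ->
  val (f A) *m (val (f C) *m val (f C)) = (val (f C) *m val (f C)) *m val (f A).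
Proof.
move=> [f1 ft] AC.
have sq B B2 : val B2 = val B *m val B -> val (f B2) = val (f B) *m val (f B).
  by move=> E; rewrite (ft B (SLP1 R n)) ?f1 /= ?mulmx1.
have Ssq B : SLP R n (val B *m val B).
  rewrite -{2}(SLP_sym (pointP B)) -[X in X *m _]mulmx1; apply: SLP_congruence.
    by rewrite (pointP B).2 mulr1.
  exact: SLP_1mx.
have SD : SLP R n (val A *m (val C *m val C) *m val A).
  rewrite -{2}(SLP_sym (pointP A)); apply: SLP_congruence => //.
  by rewrite (pointP A).2 mulr1.
apply: swap_squares_commute; rewrite ?(SLP_sym (pointP _)) ?(SLP_unit (pointP _))//.
rewrite -(sq C (point (Ssq C)))// -(sq A (point (Ssq A)))//.
rewrite -(ft A (point (Ssq C)) (point SD))// -(ft C (point (Ssq A)) (point SD))//=.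
by rewrite !mulmxA AC -!mulmxA AC.
Qed.

Lemma exp_commute (X' B : 'M[R]_n) : X'^T = X' ->
  (forall t : R, expmx (t *: X') *m B = B *m expmx (t *: X')) -> X' *m B = B *m X'.
Proof.
move=> Xs E.
have D1 := is_derive_mulmx_cst 1%:M B (is_derive_expmx 0 Xs).
have D2 := is_derive_mulmx_cst B 1%:M (is_derive_expmx 0 Xs).
have D2' : is_derive (0 : R) 1 (fun s : R => 1%:M *m expmx (s *: X') *m B)
    (B *m (expmx (0 *: X') *m X') *m 1%:M).
  rewrite (_ : (fun s : R => _) = (fun s : R => B *m expmx (s *: X') *m 1%:M)) //.
  by apply/funext => s; rewrite mul1mx mulmx1.
by have := is_derive_unique D1 D2'; rewrite scale0r expmx0 !mul1mx mulmx1.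
Qed.

Definition exp_point (X : 'M[R]_n) (Xs : symm0 X) : SLP R n := point (expmx_SLP Xs).

Lemma triple_map_commutation f (X Y X' Y' : 'M[R]_n) : triple_map f ->
  symm0 X -> symm0 Y -> symm0 X' -> symm0 Y' ->
  (forall t (Xs : symm0 (t *: X)), val (f (exp_point Xs)) = expmx (t *: X')) ->
  (forall t (Ys : symm0 (t *: Y)), val (f (exp_point Ys)) = expmx (t *: Y')) ->
  X *m Y = Y *m X -> X' *m Y' = Y' *m X'.
Proof.
move=> ft Xs Ys X's Y's fX fY XY.
have sq (t : R) : expmx (t *: Y') = expmx ((t / 2) *: Y') *m expmx ((t / 2) *: Y').
  by rewrite -expmxD ?Y's.1// -splitr.
have EE (s t : R) : expmx (s *: X') *m expmx (t *: Y') = expmx (t *: Y') *m expmx (s *: X').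
  rewrite sq -(fX s (symm0_scale s Xs)) -(fY _ (symm0_scale (t / 2) Ys)).
  apply: triple_map_commute ft _ => /=.
  apply: expmx_comm; first exact: (symm0_scale s Xs).1.
  apply/esym/expmx_comm; first exact: (symm0_scale (t / 2) Ys).1.
  by rewrite -!scalemxAl -!scalemxAr XY !scalerA mulrC.
apply: (exp_commute X's.1) => s; apply/esym; apply: (exp_commute Y's.1) => t.
exact/esym/EE.
Qed.

End TripleMaps.

Section Rigidity.
Variables (R : realType) (n : nat).
Hypothesis n1 : (1 < n)%N.
Variables G H : SLP R n -> SLP R n.
Hypothesis GK : cancel G H.
Hypothesis HK : cancel H G.
Hypothesis Gs : smooth_map G.
Hypothesis Hs : smooth_map H.
Hypothesis Gm : preserves_metric G.

(** With [V] the square root of [G(1)], the map [g = V^-1 G V^-1] fixes the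
    identity and commutes with the geodesic symmetries. Its differential [L] at
    the identity satisfies the hypotheses of [commutation_isometry], and the two
    signs there correspond to the two families of isometries. *)
Lemma isometry_classification : exists X : 'M[R]_n, det_pm1 X /\ represents X G.
Proof.
have [V VS VE] := SLP_sqrt (pointP (G (SLP1 R n))).
have Vu := SLP_unit VS; have VT := SLP_sym VS.
pose iV := invmx V.
have iVT : iV^T = iV by rewrite /iV trmx_inv VT.
have diV : \det iV * \det iV = 1 by rewrite /iV det_inv VS.2 invr1 mulr1.
have dV : \det V * \det V = 1 by rewrite VS.2 mulr1.
pose g B := point (SLP_congruence diV (pointP (G B))).
pose h B := H (point (SLP_congruence dV (pointP B))).
have gE B : val (g B) = iV *m val (G B) *m iV by rewrite /= iVT.
have gK : cancel g h.
  move=> B; rewrite /h -[RHS]GK; congr H; apply: val_inj => /=.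
  by rewrite iVT VT mulmx_conjK.
have hK : cancel h g.
  by move=> B; apply: val_inj; rewrite gE /h HK /= VT mulmx_conjVK.
have g_refl A B C : val C = val A *m invmx (val B) *m val A ->
    val (g C) = val (g A) *m invmx (val (g B)) *m val (g A).
  move=> CE; have [Z ZS ZE] := SLP_sqrt (pointP A).
  have Zu := SLP_unit ZS; have ZT := SLP_sym ZS.
  have dZ : \det Z * \det Z = 1 by rewrite ZS.2 mulr1.
  have diZ : \det (invmx Z) * \det (invmx Z) = 1.
    by rewrite det_inv ZS.2 invr1 mulr1.
  (* [A], [B] and [A B^-1 A] are the points at times 0, 1 and -1 of one geodesic. *)
  have [X Xs XE] := SLP_expmx (SLP_congruence diZ (pointP B)).
  have iZT : (invmx Z)^T = invmx Z by rewrite trmx_inv ZT.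
  have BE : val B = Z *m expmx X *m Z^T.
    by rewrite -XE iZT ZT mulmx_conjK.
  have [W WS WE] := SLP_sqrt (pointP (G A)).
  have [F ext] := Gs A.
  have AZ : val A = Z *m Z^T by rewrite ZT.
  have [Ks Kt] := isometry_geodesic GK HK Gs Hs Gm dZ Xs AZ ext WS WE.
  set K := invmx W *m _ *m _ in Ks Kt.
  clearbody K.
  have BG : B = geodesic dZ Xs 1 by apply: val_inj; rewrite /= scale1r BE.
  have CG : C = geodesic dZ Xs (- 1).
    apply: val_inj; rewrite /= scaleN1r CE BE AZ ZT.
    have -> : invmx (Z *m expmx X *m Z) = invmx Z *m expmx (- X) *m invmx Z.
      by rewrite !invmx_mulmx ?unitmx_mul ?Zu ?expmx_unit ?Xs.1// expmx_inv ?Xs.1// mulmxA.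
    rewrite !mulmxA -(mulmxA Z Z) mulmxV// mulmx1 -(mulmxA _ (invmx Z) Z) mulVmx//.
    by rewrite mulmx1.
  have Wu := SLP_unit WS.
  have iWE : invmx (iV *m (W *m expmx K *m W) *m iV) =
      V *m (invmx W *m expmx (- K) *m invmx W) *m V.
    rewrite /iV !invmx_mulmx ?unitmx_mul ?unitmx_inv ?Vu ?Wu ?expmx_unit ?Ks.1//.
    by rewrite invmxK expmx_inv ?Ks.1// !mulmxA.
  rewrite !gE BG CG !Kt scale1r scaleN1r iWE WE /iV !mulmxA.
  rewrite -(mulmxA _ (invmx V) V) mulVmx// mulmx1 -(mulmxA _ W (invmx W)) mulmxV// mulmx1.
  rewrite -(mulmxA _ V (invmx V)) mulmxV// mulmx1 -(mulmxA _ (invmx W) W) mulVmx// mulmx1.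
  by [].
have g1 : g (SLP1 R n) = SLP1 R n.
  apply: val_inj; rewrite gE VE /iV /= !mulmxA mulVmx// mul1mx mulmxV//.
have g_triple : triple_map g.
  split=> // A B C CE.
  pose iB := point (SLP_inv (pointP B)).
  have iBK : invmx (val iB) = val B by rewrite /= invmxK.
  rewrite (g_refl A iB C) ?iBK//; congr (_ *m _ *m _).
  rewrite (g_refl (SLP1 R n) B iB); last by rewrite /= mul1mx mulmx1.
  have v1 : val (SLP1 R n) = 1%:M by [].
  by rewrite g1 v1 mul1mx mulmx1 invmxK.
have [F ext] := Gs (SLP1 R n).
have [U [oU UA FU FG]] := ext.
have d1 : \det (1%:M : 'M[R]_n) * \det (1%:M : 'M[R]_n) = 1 by rewrite det1 mulr1.
have A1 : val (SLP1 R n) = 1%:M *m (1%:M)^T by rewrite trmx1 mulmx1.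
have cong1 (X : 'M[R]_n) : 1%:M *m X *m 1%:M^T = X by rewrite mul1mx trmx1 mulmx1.
pose L0 (X : 'M[R]_n) := iV *m 'd F (val (SLP1 R n)) X *m iV.
have L0lin : linear L0.
  by move=> a X Y; rewrite /L0 linearP mulmxDr mulmxDl -scalemxAr -scalemxAl.
pose L : {linear 'M[R]_n -> 'M[R]_n} := HB.pack L0 (GRing.isLinear.Build _ _ _ _ _ L0lin).
have geo1 X (Xs : symm0 X) : symm0 (L X) /\
    forall t, val (G (geodesic d1 Xs t)) = V *m expmx (t *: L X) *m V.
  have := isometry_geodesic GK HK Gs Hs Gm d1 Xs A1 ext VS VE.
  by rewrite cong1.
have Ls X : symm0 X -> symm0 (L X) by move=> Xs; case: (geo1 X Xs).
have g_exp X (Xs : symm0 X) : val (g (exp_point Xs)) = expmx (L X).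
  rewrite gE; have -> : exp_point Xs = geodesic d1 Xs 1.
    by apply: val_inj; rewrite /= scale1r cong1.
  by rewrite (geo1 X Xs).2 scale1r mulmx_conjVK.
have JE : invmx (val (G (SLP1 R n))) = iV *m iV by rewrite VE invmx_mulmx.
have Liso X Y : symm0 X -> symm0 Y -> \tr (L X *m L Y) = \tr (X *m Y).
  move=> Xs Ys.
  have := differential_isometry Gm d1 A1 oU UA FU FG Xs Ys.
  rewrite !cong1 /trace_metric JE => <-; rewrite /L /= /L0 !mulmxA [LHS]mxtrace_mulC.
  by rewrite !mulmxA.
have Lonto Y : symm0 Y -> exists2 X, symm0 X & L X = Y.
  move=> [YT Yt].
  have MT : (V *m Y *m V)^T = V *m Y *m V by rewrite !trmx_mul VT YT mulmxA.
  have Mt : \tr (invmx (val (G (SLP1 R n))) *m (V *m Y *m V)) = 0.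
    rewrite JE /iV !mulmxA -(mulmxA _ (invmx V) V) mulVmx// mulmx1 mxtrace_mulC.
    by rewrite !mulmxA mulmxV// mul1mx.
  have [X Xs XE] := differential_onto GK HK Hs d1 A1 oU UA FU FG MT Mt.
  exists X => //; rewrite /L /= /L0; move: XE; rewrite cong1 => ->.
  exact: mulmx_conjVK.
have Lcomm X Y : symm0 X -> symm0 Y -> X *m Y = Y *m X <-> L X *m L Y = L Y *m L X.
  move=> Xs Ys.
  have ge Z t (Zs : symm0 (t *: Z)) : val (g (exp_point Zs)) = expmx (t *: L Z).
    by rewrite g_exp linearZ.
  have he Z t (Zs : symm0 Z) (LZs : symm0 (t *: L Z)) : val (h (exp_point LZs)) = expmx (t *: Z).
    have tZs := symm0_scale t Zs.
    have -> : exp_point LZs = g (exp_point tZs) by apply: val_inj; rewrite ge.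
    by rewrite gK.
  split; first exact: (triple_map_commutation g_triple Xs Ys (Ls X Xs) (Ls Y Ys) (ge X) (ge Y)).
  apply: (triple_map_commutation (triple_map_inverse gK hK g_triple) (Ls X Xs) (Ls Y Ys) Xs Ys).
    by move=> t Zs; exact: he.
  by move=> t Zs; exact: he.
have [e [Q [ee oQ LE]]] := commutation_isometry n1 Ls Liso Lonto Lcomm.
exists (V *m Q); split.
  have dQ : \det Q * \det Q = 1 by rewrite -{1}det_tr -det_mulmx oQ det1.
  have dVQ : \det (V *m Q) * \det (V *m Q) = 1 by rewrite det_mulmx VS.2 mul1r.
  by split; [exact: det_pm1_unit|exact/det_pm1_sqr].
have GE A : val (G A) = V *m val (g A) *m V^T.
  by rewrite gE VT mulmx_conjK.
have expA (A : SLP R n) : exists2 X, symm0 X & val A = expmx X := SLP_expmx (pointP A).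
have gA (A : SLP R n) X (Xs : symm0 X) : val A = expmx X -> val (g A) = expmx (L X).
  by move=> AE; rewrite -(g_exp X Xs); congr (val (g _)); apply: val_inj.
have /eqP := ee; rewrite sqrf_eq1 => /orP[/eqP e1|/eqP e1]; [left|right] => A;
  have [X Xs XE] := expA A; rewrite GE (gA A X Xs XE) LE// e1.
- by rewrite scale1r expmx_conj ?Xs.1// -XE /Gamma trmx_mul !mulmxA.
- rewrite scaleN1r -mulNmx -mulmxN expmx_conj//; last by rewrite linearN /= Xs.1.
  rewrite /Gamma /inversion /= trmx_mul XE.
  by rewrite expmx_inv ?Xs.1// !mulmxA.
Qed.

End Rigidity.

(** * Congruences and inversion are isometries *)

Section Converse.
Variables (R : realType) (n : nat).
Implicit Types (G H : SLP R n -> SLP R n) (X : 'M[R]_n).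

Lemma smooth_map_global G F : (forall k, Ck_on k setT F) ->
  (forall B, F (val B) = val (G B)) -> smooth_map G.
Proof.
move=> CF FG A; exists F, setT; split=> //; first exact: openT.
Qed.

Lemma represents_smooth X G : represents X G -> smooth_map G.
Proof.
case=> GE.
  apply: (@smooth_map_global G (fun M => X *m M *m X^T)) => [k|B]; last by rewrite GE.
  by apply: Ck_congruence => i j; exact: Ck_entry.
apply: (@smooth_map_global G (fun M => X *m \adj M *m X^T)) => [k|B].
  by apply: Ck_congruence => i j; exact: Ck_adjugate_entry.
by rewrite GE /= /Gamma /inversion (SLP_invmx (pointP B)).
Qed.

(** The inverse of [A |-> X A^-1 X^T] is of the same type, for the matrix [X^T]. *)
Lemma represents_inverse X G : det_pm1 X -> represents X G ->
  exists H, [/\ cancel G H, cancel H G & exists Y, represents Y H].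
Proof.
case=> Xu /det_pm1_sqr dX GE.
have XTu : X^T \in unitmx by rewrite unitmx_tr.
have iXX : (invmx X)^T *m X^T = 1%:M by rewrite -trmx_mul mulmxV// trmx1.
have XiX : X^T *m (invmx X)^T = 1%:M by rewrite -trmx_mul mulVmx// trmx1.
have diX : \det (invmx X) * \det (invmx X) = 1.
  by rewrite det_inv -invrM ?dX ?invr1// unitfE; apply/eqP => d0; move/eqP: dX;
    rewrite d0 mulr0 eq_sym oner_eq0.
have K1 (M : 'M[R]_n) : invmx X *m (X *m M *m X^T) *m (invmx X)^T = M.
  by rewrite !mulmxA mulVmx// mul1mx -mulmxA XiX mulmx1.
have K2 (M : 'M[R]_n) : X *m (invmx X *m M *m (invmx X)^T) *m X^T = M.
  by rewrite !mulmxA mulmxV// mul1mx -mulmxA iXX mulmx1.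
case: GE => GE.
  exists (fun B => point (SLP_congruence diX (pointP B))); split.
  - by move=> A; apply: val_inj; rewrite /= GE K1.
  - by move=> B; apply: val_inj; rewrite GE /= /Gamma K2.
  - by exists (invmx X); left.
exists (fun B => point (SLP_inv (SLP_congruence diX (pointP B)))); split.
- by move=> A; apply: val_inj; rewrite /= GE /= /Gamma /inversion K1 invmxK.
- by move=> B; apply: val_inj; rewrite GE /= /Gamma /inversion invmxK K2.
exists X^T; right=> B; rewrite /= /Gamma /inversion trmxK.
have Bu := SLP_unit (pointP B).
apply: mulmx1_invmx; rewrite !mulmxA -(mulmxA _ _ X^T) iXX mulmx1.
by rewrite -(mulmxA _ (val B)) mulmxV// mulmx1 mulVmx.
Qed.

Lemma tangent_curve (A : SLP R n) V : tangent A V -> exists2 c : R -> SLP R n,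
  c 0 = A & is_derive (0 : R) 1 (fun t => val (c t)) V.
Proof.
move=> [c [U [oU U0 cU c0 dc]]]; exists c => //.
have [dcU _] := cU 1.
have D := dcU 0 U0; have D' := (derivable1_diffP (fun t : R => val (c t)) 0).2 D.
by split=> //; rewrite -derive1E.
Qed.

(** Whatever the smooth extension, its differential on a tangent vector is read off
    a curve with that velocity. *)
Lemma represents_differential X G (A : SLP R n) F V : det_pm1 X ->
  smooth_extension G A F -> tangent A V ->
  ((forall A, val (G A) = Gamma X (val A)) -> 'd F (val A) V = X *m V *m X^T) /\
  ((forall A, val (G A) = (Gamma X \o @inversion R n) (val A)) ->
    'd F (val A) V = X *m - (invmx (val A) *m V *m invmx (val A)) *m X^T).
Proof.
move=> dX ext /tangent_curve[c c0 Dc]; rewrite -c0 in ext *.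
have D1 := is_derive_image ext Dc.
split=> GE; apply: (is_derive_unique D1).
  rewrite (_ : (fun s => _) = (fun s => X *m val (c s) *m X^T)); last first.
    by apply/funext => s; rewrite GE.
  exact: is_derive_mulmx_cst.
rewrite (_ : (fun s => _) = (fun s => X *m invmx (val (c s)) *m X^T)); last first.
  by apply/funext => s; rewrite GE.
apply: is_derive_mulmx_cst.
exact: (is_derive_invmx (fun s => pointP (c s)) Dc).
Qed.

Lemma represents_preserves_metric X G : det_pm1 X -> represents X G -> preserves_metric G.
Proof.
move=> dX GE A F ext V W tV tW; have Xu := dX.1.
have Au := SLP_unit (pointP A).
have [V1 V2] := represents_differential dX ext tV.
have [W1 W2] := represents_differential dX ext tW.
case: GE => GE.
  by rewrite GE (V1 GE) (W1 GE) /Gamma trace_metric_congruence.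
rewrite GE (V2 GE) (W2 GE) /= /Gamma /inversion trace_metric_congruence ?unitmx_inv//.
rewrite /trace_metric invmxK !(mulmxN, mulNmx) opprK !mulmxA mulmxV// mul1mx.
by rewrite mulmxKV// [LHS]mxtrace_mulC !mulmxA.
Qed.

End Converse.

Theorem theorem4p3 (R : realType) (n : nat) (hn : (2 <= n)%N)
    (G : SLP R n -> SLP R n) :
  (is_isometry G <->
     exists X : 'M[R]_n, det_pm1 X /\ represents X G) /\
  (forall X : 'M[R]_n, det_pm1 X -> represents X G ->
     (G (SLP1 R n) = SLP1 R n <-> orthogonalmx X)).
Proof.
split; first split.
- move=> [[Gs [H [GK HK Hs]]] Gm].
  exact: (isometry_classification hn GK HK Gs Hs Gm).
- move=> [X [dX GE]]; split; last exact: represents_preserves_metric dX GE.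
  split; first exact: represents_smooth GE.
  have [H [GK HK [Y HE]]] := represents_inverse dX GE.
  by exists H; split=> //; exact: represents_smooth HE.
move=> X _ GE; have G1 : val (G (SLP1 R n)) = X *m X^T.
  by case: GE => ->; rewrite /= /Gamma /inversion ?invmx1 mulmx1.
split=> [GI|oX]; last by apply: val_inj; rewrite G1 orthogonalmx_tr.
by apply: mulmx1C; rewrite -G1 GI.
Qed.
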